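(* Assume that $\mathcal T_h$, $V_h$, $A_h$, $f_h$ satisfy Assumptions (A1) and (A2) stated in the context. Let $u\in H^1_0(\Omega)$ be the solution of $A(u,v)=(f,v)$ for all $v\in H^1_0(\Omega)$, and let $u_h\in V_h$ be the solution of $A_h(u_h,v_h)=\langle f_h,v_h\rangle$ for all $v_h\in V_h$. Then there exists a constant $C>0$, depending only on the coercivity and continuity constants, such that $$\|u-u_h\|_{1,h}\le C\Bigg(\inf_{v_h\in V_h}\|u-v_h\|_{1,h}+\sup_{0\ne w_h\in V_h}\frac{|\langle f_h,w_h\rangle-(f,w_h)|}{\|w_h\|_{1,h}}$$ $$+\inf_{p\in\mathcal P_k(\mathcal T_h)}\Big[\|u-p\|_{1,h}+\sum_{E\in\mathcal T_h}\ \sup_{0\neq w_h\in V_h^E}\frac{|A^E(p,w_h)-A_h^E(p,w_h)|}{\|w_h\|_{1,E}}\Big]+\sup_{0\ne w_h\in V_h}\frac{|A(u,w_h)-(f,w_h)|}{\|w_h\|_{1,h}}\Bigg),$$ where $\mathcal P_k(\mathcal T_h)=\{p\in L^2(\Omega):p|_E\in\mathcal P_k(E)\ \forall E\in\mathcal T_h\}$. The last term on the right-hand side is non-zero only if $V_h$ is nonconforming, i.e. $V_h\not\subset H^1_0(\Omega)$.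
   Context: **Continuous problem.** $\Omega\subset\mathbb R^d$, $d\in\{2,3\}$, is a polygonal ($d=2$) or polyhedral ($d=3$) domain. The coefficients $\kappa_{ij},\beta_i,\gamma$ are in $L^\infty(\Omega)$, $f\in L^\infty(\Omega)$, $\nabla\cdot\beta\in L^\infty(\Omega)$; $\kappa(x)$ is a symmetric $d\times d$ tensor and there are $\kappa_*,\kappa^*>0$ with $\kappa_*|v(x)|^2\le v(x)\cdot\kappa(x)v(x)\le\kappa^*|v(x)|^2$ for a.e. $x\in\Omega$ and all $v\in(H^1_0(\Omega))^d$; and $\mu(x):=\gamma(x)-\frac12\nabla\cdot\beta(x)\ge\mu_0\ge0$ for a.e. $x$, for some constant $\mu_0$. Set, on an element $E$, $$a^E(u,v)=\int_E\kappa\nabla u\cdot\nabla v\,dx+\int_E\mu uv\,dx,\quad b^E(u,v)=\tfrac12\int_E\big[(\beta\cdot\nabla u)v-u(\beta\cdot\nabla v)\big]dx,$$ $A^E=a^E+b^E$, and $A(u,v)=\sum_{E\in\mathcal T_h}A^E(u,v)$ for $u,v\in H^1(\mathcal T_h)$. $(\cdot,\cdot)$ is the $L^2(\Omega)$ inner product. **Notation.** $\mathcal P_\ell(E)$ is the space of polynomials of degree at most $\ell$ on $E$; $\Pi_\ell:L^2(E)\to\mathcal P_\ell(E)$ is the $L^2(E)$-orthogonal projection (componentwise on vector fields). $H^1(\mathcal T_h)=\{v\in L^2(\Omega): v|_E\in H^1(E)\ \forall E\in\mathcal T_h\}$, $|v|_{1,h}^2=\sum_E\|\nabla v\|_{0,E}^2$,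 $\|v\|_{1,h}^2=\sum_E\|v\|_{1,E}^2$, with $\|\cdot\|_{1,E}$ the $H^1(E)$ norm. $\langle\cdot,\cdot\rangle$ is the duality pairing between $V_h'$ and $V_h$. **Assumption (A1).** For fixed $h>0$ and integer $k\ge1$ we are given: - a finite decomposition (mesh) $\mathcal T_h$ of $\Omega$ into non-overlapping simple polygonal/polyhedral elements (with non-self-intersecting boundary) of maximum size $h$, where the boundary of each element consists of a uniformly bounded number of interfaces (edges if $d=2$, faces if $d=3$), each either part of $\partial\Omega$ or shared with another element; - a finite dimensional space $V_h\subset H^1(\mathcal T_h)$ (not necessarily contained in $H_0^1(\Omega)$) such that $\|v_h\|_{0,\Omega}^2\le C_{PF}|v_h|_{1,h}^2$ for all $v_h\in V_h$ (so $|\cdot|_{1,h}$ is a norm on $V_h$), and such that for each $E$ the local space $V_h^E:=V_h|_E$ contains $\mathcal P_k(E)$; - a bilinear form $A_h:V_h\times V_h\to\mathbb R$ with $A_h(u_h,v_h)=\sum_{E}A_h^E(u_h,v_h)$, $A_h^E$ a bilinear form on $V_h^E$; - an element $f_h\in V_h'$ approximating the forcing term. **Assumption (A2).** $A_h^E=a_h^E+b_h^E$ with $a_h^E$ symmetric and $b_h^E$ skew-symmetric bilinear forms on $V_h^E$ satisfying: - *Polynomial consistency*: if $u_h\in\mathcal P_k(E)$ or $v_h\in\mathcal P_k(E)$, then $$a_h^E(u_h,v_h)=\int_E\kappa\,\Pi_{k-1}(\nabla u_h)\cdot\Pi_{k-1}(\nabla v_h)\,dx+\int_E\mu\,\Pi_ku_h\,\Pi_kv_h\,dx,$$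 $$b_h^E(u_h,v_h)=\tfrac12\int_E\beta\cdot\big[\Pi_{k-1}(\nabla u_h)\Pi_kv_h-\Pi_ku_h\,\Pi_{k-1}(\nabla v_h)\big]dx.$$ - *Stability*: there are positive constants $\alpha_*,\alpha^*,C_b$ independent of $h$ and $E$ such that for all $v_h,w_h\in V_h^E$: $\alpha_*a^E(v_h,v_h)\le a_h^E(v_h,v_h)\le\alpha^*a^E(v_h,v_h)$, $b_h^E(v_h,v_h)=0$, and $b_h^E(v_h,w_h)\le C_b\|v_h\|_{1,E}\|w_h\|_{1,E}$. ''Coercivity and continuity constants'' means those of $A_h$ with respect to $\|\cdot\|_{1,h}$ on $V_h$ and of the forms $A^E$ and $A_h^E$ with respect to $\|\cdot\|_{1,E}$. *)

(* Defs.v *)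
From HB Require Import structures.
From mathcomp Require Import all_boot all_order all_algebra.
From mathcomp Require Import all_classical all_reals all_analysis.
Set Implicit Arguments.
Unset Strict Implicit.
Unset Printing Implicit Defensive.
Import Order.TTheory GRing.Theory Num.Theory.
Import numFieldNormedType.Exports.
Local Open Scope classical_set_scope.
Local Open Scope ring_scope.

(* Measurable structure on 'rV[R]_n generated by the coordinates (this is the
   Borel sigma-algebra), as the library does for n.-tuple T. *)

Fact measure_rV_display : measure_display.
Proof. exact: default_measure_display. Qed.

Section measurable_rV.
Context {R : realType}.
Variable n : nat.

Let coors : 'I_n -> 'rV[R]_n -> R := fun i v => v 0 i.

Let rV_set0 : g_sigma_preimage coors set0.
Proof. exact: sigma_algebra0. Qed.

Let rV_setC A : g_sigma_preimage coors A -> g_sigma_preimage coors (~` A).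
Proof. exact: sigma_algebraC. Qed.

Let rV_bigcup (F : _^nat) : (forall i, g_sigma_preimage coors (F i)) ->
  g_sigma_preimage coors (\bigcup_i (F i)).
Proof. exact: sigma_algebra_bigcup. Qed.

HB.instance Definition _ := @isMeasurable.Build measure_rV_display
  'rV[R]_n (g_sigma_preimage coors) rV_set0 rV_setC rV_bigcup.

Lemma measurable_coor (i : 'I_n) :
  measurable_fun [set: 'rV[R]_n] (fun v : 'rV[R]_n => v 0 i).
Proof.
move=> _ Y mY; rewrite setTI; apply: sub_sigma_algebra => /=.
rewrite -bigcup_seq/=; exists i => /=; first by rewrite mem_index_enum.
by exists Y => //; rewrite setTI.
Qed.

Lemma measurable_fun_rVP d (T : measurableType d) (f : T -> 'rV[R]_n) :
  (forall i, measurable_fun [set: T] (fun x => f x 0 i)) ->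
  measurable_fun [set: T] f.
Proof.
move=> mf.
suff prefS : g_sigma_preimage (fun i => coors i \o f) `<=` measurable.
  move=> _ A mA; apply: prefS; rewrite g_sigma_preimage_comp.
  by exists A.
apply: smallest_sub; first exact: sigma_algebra_measurable.
rewrite -bigcup_seq; apply: bigcup_sub => i _ A [B mB <-]; exact: mf.
Qed.

End measurable_rV.

(* lebesgue_rV n is the n-dimensional Lebesgue measure: lebesgue_rV n.+1 is the
   product lebesgue_measure \x lebesgue_rV n carried to row vectors by cons_rV. *)
Section lebesgue_rV.
Context {R : realType}.

Definition cons_rV n (p : R * 'rV[R]_n) : 'rV[R]_n.+1 :=
  row_mx (p.1%:M : 'rV_1) p.2.

Definition split_rV n (v : 'rV[R]_n.+1) : R * 'rV[R]_n :=
  (v 0 ord0, rsubmx (v : 'rV_(1 + n))).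

Lemma cons_rVK n : cancel (@cons_rV n) (@split_rV n).
Proof.
move=> [a v]; congr (_, _); last exact: row_mxKr.
have -> : ord0 = lshift n (ord0 : 'I_1) by exact/val_inj.
by rewrite /=; apply: etrans (row_mxEl _ _ _ _) _; rewrite mxE eqxx.
Qed.

Lemma measurable_cons_rV n : measurable_fun setT (@cons_rV n).
Proof.
apply: measurable_fun_rVP => i.
case: (@split_ordP 1 n i) => j ->.
  rewrite (_ : (fun _ => _) = fst)//; apply/funext => -[a v].
  by apply: etrans (row_mxEl _ _ _ _) _; rewrite mxE !ord1 eqxx.
rewrite (_ : (fun _ => _) = (fun v : 'rV[R]_n => v 0 j) \o snd).
  by apply: measurableT_comp => //; exact: measurable_coor.
by apply/funext => -[a v]; exact: row_mxEr.
Qed.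

Lemma measurable_split_rV n : measurable_fun setT (@split_rV n).
Proof.
apply: measurable_fun_pair; first exact: measurable_coor.
apply: measurable_fun_rVP => i.
rewrite (_ : (fun _ => _) = (fun v : 'rV[R]_n.+1 => v 0 (rshift 1 i))).
  exact: measurable_coor.
by apply/funext => v; rewrite mxE.
Qed.

Section step.
Variables (n : nat) (m : {sigma_finite_measure set 'rV[R]_n -> \bar R}).

Definition lebesgue_step : set 'rV[R]_n.+1 -> \bar R :=
  pushforward (@lebesgue_measure R \x m)%E (@cons_rV n).

Let mcons A : measurable A -> measurable (@cons_rV n @^-1` A).
Proof. by move=> mA; rewrite -[X in measurable X]setTI; exact: measurable_cons_rV. Qed.

Let lebesgue_step0 : lebesgue_step set0 = 0%E.
Proof. by rewrite /lebesgue_step /pushforward preimage_set0 measure0. Qed.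

Let lebesgue_step_ge0 A : (0 <= lebesgue_step A)%E.
Proof. exact: (measure_ge0 (lebesgue_measure \x m)%E). Qed.

Let lebesgue_step_sigma_additive : semi_sigma_additive lebesgue_step.
Proof.
move=> F mF tF mUF; rewrite /lebesgue_step /pushforward preimage_bigcup.
apply: measure_semi_sigma_additive => [i||]; first exact: mcons.
- apply/trivIsetP => /= i j _ _ ij; rewrite -preimage_setI.
  by move/trivIsetP : tF => /(_ _ _ _ _ ij) ->//; rewrite preimage_set0.
- by rewrite -preimage_bigcup; exact: mcons.
Qed.

HB.instance Definition _ := isMeasure.Build _ _ _ lebesgue_step
  lebesgue_step0 lebesgue_step_ge0 lebesgue_step_sigma_additive.

Let lebesgue_step_sigma_finite : sigma_finite setT lebesgue_step.
Proof.
have /sigma_finiteP[F [FT ndF Foo]] := sigma_finiteT (@lebesgue_measure R).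
have /sigma_finiteP[G [GT ndG Goo]] := sigma_finiteT m.
exists (fun k => @split_rV n @^-1` (F k `*` G k)).
  rewrite -preimage_bigcup (_ : \bigcup_i _ = setT) ?preimage_setT//.
  apply/seteqP; split=> // -[x y] _.
  have [i _ Fx] : (\bigcup_i F i) x by rewrite -FT.
  have [j _ Gy] : (\bigcup_i G i) y by rewrite -GT.
  exists (maxn i j) => //; split => /=.
    by move: x Fx; exact/subsetPset/ndF/leq_maxl.
  by move: y Gy; exact/subsetPset/ndG/leq_maxr.
move=> k; have [mF Fk] := Foo k; have [mG Gk] := Goo k; split.
  rewrite -[X in measurable X]setTI; apply: measurable_split_rV => //.
  exact: measurableX.
rewrite /lebesgue_step /pushforward -comp_preimage.
rewrite (_ : _ \o _ = id); last by apply/funext => p; exact: cons_rVK.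
rewrite preimage_id product_measure1E// lte_mul_pinfty//.
by rewrite ge0_fin_numE.
Qed.

HB.instance Definition _ := Measure_isSigmaFinite.Build _ _ _ lebesgue_step
  lebesgue_step_sigma_finite.

End step.

Fixpoint lebesgue_rV n : {sigma_finite_measure set 'rV[R]_n -> \bar R} :=
  if n is n'.+1 return {sigma_finite_measure set 'rV[R]_n -> \bar R}
  then lebesgue_step (lebesgue_rV n') else dirac (0 : 'rV[R]_0).

End lebesgue_rV.

Section geometry.
Context {R : realType}.

Definition dotv n (x y : 'rV[R]_n) : R := \sum_i x 0 i * y 0 i.

(* Euclidean norm; the library norm on matrices is the max norm. *)
Definition enorm n (x : 'rV[R]_n) : R := Num.sqrt (dotv x x).

Definition diam n (A : set 'rV[R]_n) : R :=
  sup [set enorm (x - y) | x in A & y in A].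

Definition frontier (T : topologicalType) (A : set T) : set T :=
  closure A `\` interior A.

Definition conv_hull m n (p : 'I_m -> 'rV[R]_n) : set 'rV[R]_n :=
  [set x | exists t : 'I_m -> R, [/\ forall j, 0 <= t j, \sum_j t j = 1
                                  & x = \sum_j t j *: p j]].

Definition affinely_independent m n (p : 'I_m -> 'rV[R]_n) : Prop :=
  forall t : 'I_m -> R,
    \sum_j t j = 0 -> \sum_j t j *: p j = 0 -> forall j, t j = 0.

(* A bounded domain whose boundary is a finite union of (n-1)-simplices:
   a polygonal domain for n = 2, a polyhedral domain for n = 3, and a bounded
   open interval for n = 1. *)
Definition polytopal_domain n (D : set 'rV[R]_n) : Prop :=
  [/\ D !=set0, open D, bounded_set D, connected D &
    exists (N : nat) (p : 'I_N -> 'I_n -> 'rV[R]_n),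
      (forall s, affinely_independent (p s)) /\
      frontier D = \bigcup_s conv_hull (p s)].

(* A simple polytope has a non-self-intersecting boundary: the boundary is a
   connected topological (n-1)-manifold (a simple closed curve for n = 2, a
   closed surface for n = 3). *)
Definition simple_polytope n (E : set 'rV[R]_n) : Prop :=
  [/\ polytopal_domain E, connected (frontier E) &
    forall x, frontier E x ->
    exists (U : set 'rV[R]_n)
           (phi : 'rV[R]_n.-1 -> 'rV[R]_n) (psi : 'rV[R]_n -> 'rV[R]_n.-1),
      [/\ open U /\ U x, continuous phi,
          range phi = frontier E `&` U,
          {within frontier E `&` U, continuous psi} & cancel phi psi]].

(* Relatively open (n-1)-dimensional flat piece, the image of a polytopal
   domain of R^(n-1) under an injective affine map: an open segment for n = 2,
   the relative interior of a planar polygonal face for n = 3. *)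
Definition interface n (F : set 'rV[R]_n) : Prop :=
  exists (D : set 'rV[R]_n.-1) (a : 'rV[R]_n) (M : 'M[R]_(n.-1, n)),
    [/\ polytopal_domain D, row_free M & F = [set a + y *m M | y in D]].

End geometry.

(* Elements of L^2(E), H^1(E), ... are represented by functions on the whole
   space whose values outside E are irrelevant, and are compared by aeeq E. *)

Section spaces.
Context {R : realType} {d : nat}.
Local Notation X := 'rV[R]_d.
Local Notation lam := (@lebesgue_rV R d).
Implicit Types (E : set X) (u v w : X -> R) (g : X -> X).

Definition aeeq E u v : Prop := {ae lam, forall x, E x -> u x = v x}.

Definition L2 E v : Prop := v \_ E \in Lfun lam 2%:E.

Definition Linf E v : Prop := v \_ E \in Lfun lam +oo%E.

Definition ip E u v : R := \int[lam]_(x in E) (u x * v x).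

Definition partial (i : 'I_d) v : X -> R := fun x => 'D_(delta_mx 0 i) v x.

Fixpoint Ck (m : nat) v : Prop :=
  continuous v /\
  if m is m'.+1 then
    forall i, (forall x, derivable v x (delta_mx 0 i)) /\ Ck m' (partial i v)
  else True.

(* The test functions C_c^oo(E). *)
Definition test_function E v : Prop :=
  [/\ forall m, Ck m v, compact (closure [set x | v x != 0])
    & closure [set x | v x != 0] `<=` E].

Definition is_wgrad E v g : Prop :=
  (forall i, L2 E (fun x => g x 0 i)) /\
  (forall phi, test_function E phi -> forall i,
     \int[lam]_(x in E) (v x * partial i phi x) =
     - \int[lam]_(x in E) (g x 0 i * phi x)).

Definition wgrad E v : X -> X := xget (fun=> 0) [set g | is_wgrad E v g].

Definition H1 E v : Prop := L2 E v /\ exists g, is_wgrad E v g.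

Definition L2sqnorm E v : R := \int[lam]_(x in E) (v x ^+ 2).

Definition H1sqsemi E v : R :=
  \int[lam]_(x in E) dotv (wgrad E v x) (wgrad E v x).

Definition H1norm E v : R := Num.sqrt (L2sqnorm E v + H1sqsemi E v).

(* H^1_0(E) is the closure of C_c^oo(E) in H^1(E). *)
Definition H10 E v : Prop :=
  H1 E v /\ forall e, 0 < e ->
    exists2 phi, test_function E phi & H1norm E (v \- phi) < e.

Definition is_wdiv E (beta : X -> X) v : Prop :=
  forall phi, test_function E phi ->
    \int[lam]_(x in E) (\sum_i beta x 0 i * partial i phi x) =
    - \int[lam]_(x in E) (v x * phi x).

(* Polynomial functions on R^d of total degree at most l. *)
Definition polyn (l : nat) (p : X -> R) : Prop :=
  exists c : {ffun 'I_d -> 'I_l.+1} -> R, forall x,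
    p x = \sum_(a : {ffun 'I_d -> 'I_l.+1} | (\sum_i a i <= l)%N)
            c a * \prod_i x 0 i ^+ a i.

(* v|_E belongs to P_l(E). *)
Definition poly_on E (l : nat) v : Prop := exists2 p, polyn l p & aeeq E v p.

(* The L^2(E)-orthogonal projection onto P_l(E). *)
Definition proj E (l : nat) v : X -> R :=
  xget (fun=> 0) [set p | polyn l p /\ forall q, polyn l q -> ip E (v \- p) q = 0].

Definition projv E (l : nat) g : X -> X :=
  fun x => \row_i proj E l (fun y => g y 0 i) x.

Definition bilinear_on E (V : set (X -> R)) (B : (X -> R) -> (X -> R) -> R) : Prop :=
  [/\ forall (a : R) u u' v, V u -> V u' -> V v ->
         B (fun x => a * u x + u' x) v = a * B u v + B u' v,
      forall (a : R) u v v', V u -> V v -> V v' ->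
         B u (fun x => a * v x + v' x) = a * B u v + B u v' &
      forall u u' v v', V u -> V u' -> V v -> V v' ->
         aeeq E u u' -> aeeq E v v' -> B u v = B u' v'].

Definition linear_functional_on E (V : set (X -> R)) (F : (X -> R) -> R) : Prop :=
  (forall (a : R) v v', V v -> V v' ->
     F (fun x => a * v x + v' x) = a * F v + F v') /\
  (forall v v', V v -> V v' -> aeeq E v v' -> F v = F v').

End spaces.

Record coefficients (R : realType) (d : nat) := Coefficients {
  kappa : 'rV[R]_d -> 'M[R]_d;
  beta : 'rV[R]_d -> 'rV[R]_d;
  divbeta : 'rV[R]_d -> R;
  gamma : 'rV[R]_d -> R
}.

Section continuous_problem.
Context {R : realType} {d : nat}.
Local Notation X := 'rV[R]_d.
Local Notation lam := (@lebesgue_rV R d).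
Variable c : coefficients R d.

Definition mu : X -> R := fun x => gamma c x - 2^-1 * divbeta c x.

(* kappa(x) xi, for row vectors xi. *)
Definition kmul (x xi : X) : X := xi *m (kappa c x)^T.

Definition continuous_problem (Omega : set X) (f : X -> R)
    (kappa_lo kappa_up mu0 : R) : Prop :=
  [/\ polytopal_domain Omega,
      [/\ forall i j, Linf Omega (fun x => kappa c x i j),
          forall i, Linf Omega (fun x => beta c x 0 i),
          Linf Omega (gamma c) & Linf Omega f],
      is_wdiv Omega (beta c) (divbeta c) /\ Linf Omega (divbeta c),
      [/\ 0 < kappa_lo, 0 < kappa_up,
          {ae lam, forall x, Omega x -> (kappa c x)^T = kappa c x} &
          {ae lam, forall x, Omega x -> forall v : X -> X,
             (forall i, H10 Omega (fun y => v y 0 i)) ->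
             kappa_lo * dotv (v x) (v x) <= dotv (v x) (kmul x (v x))
               <= kappa_up * dotv (v x) (v x)}] &
      0 <= mu0 /\ {ae lam, forall x, Omega x -> mu0 <= mu x}].

Definition aE (E : set X) (u v : X -> R) : R :=
  \int[lam]_(x in E) dotv (kmul x (wgrad E u x)) (wgrad E v x) +
  \int[lam]_(x in E) (mu x * u x * v x).

Definition bE (E : set X) (u v : X -> R) : R :=
  2^-1 * \int[lam]_(x in E)
    (dotv (beta c x) (wgrad E u x) * v x - u x * dotv (beta c x) (wgrad E v x)).

Definition AE (E : set X) (u v : X -> R) : R := aE E u v + bE E u v.

(* The right-hand sides of the polynomial consistency conditions. *)
Definition aE_proj (E : set X) (k : nat) (u v : X -> R) : R :=
  \int[lam]_(x in E) dotv (kmul x (projv E k.-1 (wgrad E u) x))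
                           (projv E k.-1 (wgrad E v) x) +
  \int[lam]_(x in E) (mu x * proj E k u x * proj E k v x).

Definition bE_proj (E : set X) (k : nat) (u v : X -> R) : R :=
  2^-1 * \int[lam]_(x in E)
    dotv (beta c x) (proj E k v x *: projv E k.-1 (wgrad E u) x -
                     proj E k u x *: projv E k.-1 (wgrad E v) x).

End continuous_problem.

Record discretization (R : realType) (d : nat) := Discretization {
  elt : finType;
  cell : elt -> set 'rV[R]_d;
  nface : elt -> nat;
  face : forall i : elt, 'I_(nface i) -> set 'rV[R]_d;
  (* only the values of the forms on (restrictions of) elements of Vh matter *)
  Vh : set ('rV[R]_d -> R);
  ah : elt -> ('rV[R]_d -> R) -> ('rV[R]_d -> R) -> R;
  bh : elt -> ('rV[R]_d -> R) -> ('rV[R]_d -> R) -> R;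
  fh : ('rV[R]_d -> R) -> R
}.

Arguments cell {R d} D i : rename.
Arguments nface {R d} D i : rename.
Arguments face {R d} D i s : rename.
Arguments ah {R d} D i u v : rename.
Arguments bh {R d} D i u v : rename.

Section discrete_problem.
Context {R : realType} {d : nat}.
Local Notation X := 'rV[R]_d.
Local Notation lam := (@lebesgue_rV R d).
Variables (c : coefficients R d) (D : discretization R d).
Implicit Types (Omega : set X) (i : elt D) (u v w : X -> R).

(* Cells are open, and faces are relatively open; "uniformly bounded" is the
   bound N on the number of interfaces per element. *)
Definition is_mesh Omega (h : R) (N : nat) : Prop :=
  [/\ [/\ forall i, simple_polytope (cell D i),
          forall i j, i != j -> cell D i `&` cell D j = set0 &
          closure Omega = \bigcup_i closure (cell D i)],
      (forall i, cell D i `<=` Omega),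
      (forall i, diam (cell D i) <= h) /\ (exists i, diam (cell D i) = h),
      [/\ forall i, (nface D i <= N)%N,
          forall i (s : 'I_(nface D i)), interface (face D i s),
          forall i (s t : 'I_(nface D i)), s != t -> face D i s `&` face D i t = set0 &
          forall i, frontier (cell D i) = \bigcup_s closure (face D i s)] &
      forall i (s : 'I_(nface D i)), face D i s `<=` frontier Omega \/
        exists j, exists2 t : 'I_(nface D j), j != i & face D j t = face D i s].

(* H^1(T_h) *)
Definition H1h Omega v : Prop := L2 Omega v /\ forall i, H1 (cell D i) v.

Definition H1hsqsemi v : R := \sum_i H1sqsemi (cell D i) v.

Definition H1hnorm v : R := Num.sqrt (\sum_i H1norm (cell D i) v ^+ 2).

(* P_k(T_h) *)
Definition polyh Omega (k : nat) p : Prop :=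
  L2 Omega p /\ forall i, poly_on (cell D i) k p.

(* V_h^E = V_h|_E *)
Definition VhE i : set (X -> R) :=
  [set w | L2 (cell D i) w /\ exists2 v, Vh D v & aeeq (cell D i) w v].

(* A finite-dimensional subspace of H^1(T_h), closed under change of
   representative. *)
Definition findim_subspace Omega (V : set (X -> R)) : Prop :=
  exists (N : nat) (phi : 'I_N -> X -> R),
    (forall n, H1h Omega (phi n)) /\
    forall v, V v <-> H1h Omega v /\
      exists a : 'I_N -> R, aeeq Omega v (fun x => \sum_n a n * phi n x).

Definition AhE i u v : R := ah D i u v + bh D i u v.

Definition Ah u v : R := \sum_(i : elt D) AhE i u v.

Definition A u v : R := \sum_i AE c (cell D i) u v.

Definition assumption_A1 Omega (h : R) (k N : nat) (C_PF : R) : Prop :=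
  [/\ [/\ 0 < h, (1 <= k)%N & is_mesh Omega h N],
      findim_subspace Omega (Vh D),
      0 < C_PF /\ (forall v, Vh D v -> L2sqnorm Omega v <= C_PF * H1hsqsemi v),
      (forall i p, polyn k p -> VhE i p) &
      (forall i, bilinear_on (cell D i) (VhE i) (AhE i)) /\
      linear_functional_on Omega (Vh D) (fh D)].

Definition assumption_A2 (k : nat) (alpha_lo alpha_up C_b : R) : Prop :=
  [/\ forall i, [/\ bilinear_on (cell D i) (VhE i) (ah D i),
                    bilinear_on (cell D i) (VhE i) (bh D i),
                    forall u v, VhE i u -> VhE i v -> ah D i u v = ah D i v u &
                    forall u v, VhE i u -> VhE i v -> bh D i u v = - bh D i v u],
      forall i u v, VhE i u -> VhE i v ->
        poly_on (cell D i) k u \/ poly_on (cell D i) k v ->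
        ah D i u v = aE_proj c (cell D i) k u v /\
        bh D i u v = bE_proj c (cell D i) k u v,
      [/\ 0 < alpha_lo, 0 < alpha_up & 0 < C_b],
      forall i v, VhE i v ->
        alpha_lo * aE c (cell D i) v v <= ah D i v v <= alpha_up * aE c (cell D i) v v
        /\ bh D i v v = 0 &
      forall i v w, VhE i v -> VhE i w ->
        bh D i v w <= C_b * H1norm (cell D i) v * H1norm (cell D i) w].

(* alpha is a coercivity constant and M a continuity constant of A_h for
   ||.||_{1,h} on V_h; M_A and M_h are continuity constants of the forms A^E on
   H^1(E) and A_h^E on V_h^E for ||.||_{1,E}, uniform in E. *)
Definition coercivity_continuity (alpha M M_A M_h : R) : Prop :=
  [/\ [/\ 0 < alpha, 0 < M, 0 < M_A & 0 < M_h],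
      (forall v, Vh D v -> alpha * H1hnorm v ^+ 2 <= Ah v v),
      (forall v w, Vh D v -> Vh D w -> `|Ah v w| <= M * H1hnorm v * H1hnorm w),
      (forall i v w, H1 (cell D i) v -> H1 (cell D i) w ->
        `|AE c (cell D i) v w| <= M_A * H1norm (cell D i) v * H1norm (cell D i) w) &
      (forall i v w, VhE i v -> VhE i w ->
        `|AhE i v w| <= M_h * H1norm (cell D i) v * H1norm (cell D i) w)].

Local Open Scope ereal_scope.

Definition best_approximation u : \bar R :=
  ereal_inf [set (H1hnorm (u \- v))%:E | v in Vh D].

Definition load_error Omega (f : X -> R) : \bar R :=
  ereal_sup [set (`|fh D w - ip Omega f w| / H1hnorm w)%:E
            | w in [set w | Vh D w /\ ~ aeeq Omega w (fun=> 0%R)]].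

Definition local_inconsistency i (p : X -> R) : \bar R :=
  ereal_sup [set (`|AE c (cell D i) p w - AhE i p w| / H1norm (cell D i) w)%:E
            | w in [set w | VhE i w /\ ~ aeeq (cell D i) w (fun=> 0%R)]].

Definition polynomial_error Omega (k : nat) u : \bar R :=
  ereal_inf [set (H1hnorm (u \- p))%:E + \sum_i local_inconsistency i p
            | p in polyh Omega k].

Definition nonconformity_error Omega (f u : X -> R) : \bar R :=
  ereal_sup [set (`|A u w - ip Omega f w| / H1hnorm w)%:E
            | w in [set w | Vh D w /\ ~ aeeq Omega w (fun=> 0%R)]].

End discrete_problem.

(* Main.v *)
Require Import Defs.
From mathcomp Require Import all_boot all_order all_algebra.
From mathcomp Require Import all_classical all_reals all_analysis.
From mathcomp Require Import measurable_realfun ess_sup_inf.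
From mathcomp Require Import ring lra.
Set Implicit Arguments.
Unset Strict Implicit.
Unset Printing Implicit Defensive.
Import Order.TTheory GRing.Theory Num.Theory.
Import numFieldNormedType.Exports.
Local Open Scope classical_set_scope.
Local Open Scope ring_scope.

(** The estimate is a Strang lemma. Write N for the broken norm. For a discrete
    function vh put e = uh - vh. Coercivity and the equation for uh give

      alpha N(e)^2 <= Ah(e, e) = (<fh, e> - (f, e)) - (A(u, e) - (f, e))
         + sum_E (AE(u - p, e) + (AE(p, e) - AhE(p, e)) + AhE(p - vh, e))

    for every piecewise polynomial p. The first two groups are bounded by the
    load and nonconformity suprema times N(e), the third by continuity and the
    Cauchy-Schwarz inequality over the elements. Dividing by alpha N(e) and
    using N(u - uh) <= N(u - vh) + N(e) yields the constant
    1 + (1 + M_A + M_h) / alpha ([strang_arithmetic], [strang_bound]).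
    Passing to the infima over vh and p requires every error term to be
    nonnegative, that is, every supremum to range over a nonempty set; this
    comes from the constant function 1, which belongs to every local space
    ([Vh_neq0], [local_inconsistency_ge0]).

    The nonconformity supremum vanishes for a conforming space because each of
    its members may then be tested in the equation for u
    ([nonconformity_error_conforming]).

    The argument rests on the triangle and Cauchy-Schwarz inequalities for the
    broken norm and on the linearity of the forms. The weak gradient is a chosen representative, so its
    linearity has to come from uniqueness almost everywhere
    ([is_wgrad_unique]), which is the fundamental lemma of the calculus of
    variations ([test_functions_separate]). Its proof approximates the
    indicator of a box by smooth compactly supported functions built from
    exp(-1/t) ([cutoff]); testing against them shows that the function
    integrates to zero over every box, and a pi-lambda argument then makes it
    zero almost everywhere. Once gradients are linear, the H^1 inner product
    and the forms aE and AE are instances of one bilinear form [jet_form] in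
    the function and its first derivatives.

    The coercivity constant of Ah follows from the lower stability bound, the
    ellipticity of kappa and the discrete Poincare inequality
    ([Ah_coercive]); the continuity of AhE follows from the Cauchy-Schwarz
    inequality for the semi-inner product ah ([AhE_continuous]). *)

(** * Boxes and Lebesgue measure on row vectors *)

Section boxes.
Context {R : realType}.

Definition box n (a b : 'I_n -> R) : set 'rV[R]_n :=
  [set x | forall i, a i < x 0 i < b i].

Definition cbox n (a b : 'I_n -> R) : set 'rV[R]_n :=
  [set x | forall i, a i <= x 0 i <= b i].

Lemma box_sub_cbox n (a b : 'I_n -> R) : box a b `<=` cbox a b.
Proof. by move=> x xab i; case/andP: (xab i) => ? ?; rewrite !ltW. Qed.

Lemma measurable_box n (a b : 'I_n -> R) : measurable (box a b).
Proof.
rewrite (_ : box a b =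
    \bigcap_(i in [set: 'I_n]) ((fun v : 'rV[R]_n => v 0 i) @^-1` `]a i, b i[)).
  apply: fin_bigcap_measurable => // i _.
  by rewrite -[X in measurable X]setTI; exact: measurable_coor.
apply/seteqP; split=> x /= xab i => [_|]; first by rewrite /= in_itv; exact: xab.
by have := xab i I; rewrite /= in_itv.
Qed.

(** Rational corners make the boxes countable, and a closed box inside [U]
    leaves room for test functions supported in [U]. *)
Lemma open_rat_box n (U : set 'rV[R]_n) x : open U -> U x ->
  exists q r : {ffun 'I_n -> rat},
    box (fun i => ratr (q i)) (fun i => ratr (r i)) x /\
    cbox (fun i => ratr (q i)) (fun i => ratr (r i)) `<=` U.
Proof.
move=> oU Ux.
have /nbhs_ballP[e /= e0 eU] : nbhs x U by apply: open_nbhs_nbhs.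
have ex_rat (y : R) : exists q, y - e < ratr q < y.
  have : y - e < y by rewrite ltrBlDr ltrDl.
  by move/rat_in_itvoo => [q]; rewrite in_itv /= => qy; exists q.
have ex_rat' (y : R) : exists q, y < ratr q < y + e.
  have : y < y + e by rewrite ltrDl.
  by move/rat_in_itvoo => [q]; rewrite in_itv /= => qy; exists q.
pose q := [ffun i : 'I_n => sval (cid (ex_rat (x 0 i)))].
pose r := [ffun i : 'I_n => sval (cid (ex_rat' (x 0 i)))].
have qP i : x 0 i - e < ratr (q i) < x 0 i by rewrite ffunE; case: cid.
have rP i : x 0 i < ratr (r i) < x 0 i + e by rewrite ffunE; case: cid.
exists q, r; split=> [i|y yqr].
  by have /andP[_ ->] := qP i; have /andP[-> _] := rP i.
apply: eU; split=> // i j; rewrite (ord1 i) /ball /= /ball_.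
have /andP[q1 _] := qP j; have /andP[_ r1] := rP j; have /andP[y1 y2] := yqr j.
by rewrite ltr_norml; apply/andP; split; lra.
Qed.

(** Empty sets fill the indices that decode to no admissible rational box. *)
Lemma open_bigcup_box n (U : set 'rV[R]_n) : open U ->
  exists F : (set 'rV[R]_n)^nat, U = \bigcup_k F k /\
    forall k, F k = set0 \/ exists a b, F k = box a b /\ cbox a b `<=` U.
Proof.
move=> oU; pose I := ({ffun 'I_n -> rat} * {ffun 'I_n -> rat})%type.
pose bx (p : I) := box (fun i => ratr (p.1 i) : R) (fun i => ratr (p.2 i)).
pose cb (p : I) := cbox (fun i => ratr (p.1 i) : R) (fun i => ratr (p.2 i)).
pose F k := if unpickle k is Some p then
              if `[< cb p `<=` U >] then bx p else set0 else set0.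
exists F; split; last first.
  move=> k; rewrite /F; case: unpickle => [p|]; last by left.
  case: asboolP => pU; last by left.
  by right; exists (fun i => ratr (p.1 i)), (fun i => ratr (p.2 i)).
apply/seteqP; split=> [x Ux|x [k _]].
  have [q [r [xqr qrU]]] := open_rat_box oU Ux.
  by exists (pickle ((q, r) : I)) => //; rewrite /F pickleK asboolT.
rewrite /F; case: unpickle => [p|//]; case: asboolP => // pU xp.
exact/pU/box_sub_cbox.
Qed.

(** The measurable sets are generated by the coordinates; they contain the open
    sets since the topology has a countable base of boxes. *)
Lemma open_measurable_rV n (U : set 'rV[R]_n) : open U -> measurable U.
Proof.
move=> /open_bigcup_box[F [-> FP]]; apply: bigcupT_measurable => k.
have [->//|[a [b [-> _]]]] := FP k; exact: measurable_box.
Qed.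

Lemma continuous_measurable_rV n (f : 'rV[R]_n -> R) :
  continuous f -> measurable_fun [set: 'rV[R]_n] f.
Proof.
move=> cf; apply: (measurability _ (RGenOInfty.measurableE R)) => // _ [_ [a ->] <-].
rewrite setTI; apply: open_measurable_rV.
by apply: open_comp => [x _|]; [exact: cf|exact: interval_open].
Qed.

(** By induction on the dimension: [cons_rV] turns a box into the product of an
    interval and a box of one dimension less. *)
Lemma lebesgue_rV_box n (a b : 'I_n -> R) : (forall i, a i < b i) ->
  (0 < lebesgue_rV n (box a b) < +oo)%E.
Proof.
elim: n => [|n IH] in a b *; move=> ab.
  rewrite (_ : box a b = setT) /=.
    by rewrite diracT lte01 ltry.
  by apply/seteqP; split=> // x _ [].
have ab' : forall i : 'I_n, a (lift ord0 i) < b (lift ord0 i) by [].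
have /andP[I0 Ioo] := IH _ _ ab'.
rewrite /= /lebesgue_step /pushforward.
set B := box (fun i => a (lift ord0 i)) (fun i => b (lift ord0 i)) in I0 Ioo.
rewrite (_ : _ @^-1` _ = `]a ord0, b ord0[%classic `*` B).
  rewrite product_measure1E//; last exact: measurable_box.
  have leb_ab : lebesgue_measure `]a ord0, b ord0[%classic = (b ord0 - a ord0)%:E.
    by rewrite lebesgue_measure_itv /= lte_fin ab -EFinD.
  rewrite [X in (X * _)%E](_ : _ = (b ord0 - a ord0)%:E)//.
  by rewrite mule_gt0 ?lte_fin ?subr_gt0 ?ab// lte_mul_pinfty// lee_fin subr_ge0 ltW.
have c0 (p : R * 'rV[R]_n) : cons_rV p 0 ord0 = p.1.
  by have := cons_rVK p; case: p => p1 p2 /= [].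
have cS (p : R * 'rV[R]_n) i : cons_rV p 0 (lift ord0 i) = p.2 0 i.
  have -> : lift ord0 i = rshift 1 i by apply/val_inj.
  exact: row_mxEr.
apply/seteqP; split=> [p pB|p [/= p1 p2] i].
  split; first by have := pB ord0; rewrite c0 /= in_itv.
  by move=> i; have := pB (lift ord0 i); rewrite cS.
have [j ->|->] := unliftP ord0 i; first by rewrite cS; exact: p2.
by rewrite c0; rewrite in_itv in p1.
Qed.

Lemma lebesgue_rV_open_gt0 n (U : set 'rV[R]_n) : open U -> U !=set0 ->
  (0 < lebesgue_rV n U)%E.
Proof.
move=> oU [x Ux]; have [q [r [xqr qrU]]] := open_rat_box oU Ux.
have qr i : ratr (q i) < ratr (r i) :> R.
  by have /andP[] := xqr i; exact: lt_trans.
have /andP[B0 _] := lebesgue_rV_box qr; apply: (lt_le_trans B0).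
apply: le_measure; rewrite ?inE; [exact: measurable_box|exact: open_measurable_rV|].
exact: subset_trans (@box_sub_cbox _ _ _) qrU.
Qed.

Lemma ler_coor_norm n (x : 'rV[R]_n) i : `|x 0 i| <= `|x|.
Proof.
rewrite [leRHS]/Num.Def.normr /= mx_normrE.
by apply/bigmax_geP; right => /=; exists (0, i).
Qed.

Lemma bounded_sub_box n (A : set 'rV[R]_n) : bounded_set A ->
  exists2 M : R, 0 < M & A `<=` box (fun=> - M) (fun=> M).
Proof.
move=> [M [_ MA]]; exists (`|M| + 2); first by rewrite ltr_wpDl.
move=> x Ax i.
have := MA (`|M| + 1) _ x Ax; rewrite (le_lt_trans (ler_norm M)) ?ltrDl// => /(_ isT).
move=> /(le_trans (ler_coor_norm x i)).
by rewrite ler_norml => /andP[? ?]; apply/andP; split; lra.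
Qed.

Lemma lebesgue_rV_bounded n (A : set 'rV[R]_n) : measurable A -> bounded_set A ->
  (lebesgue_rV n A < +oo)%E.
Proof.
move=> mA /bounded_sub_box[M M0 AM].
have /(@lebesgue_rV_box n)/andP[_] : forall i : 'I_n, - M < M.
  by move=> _; rewrite gtrN.
apply: le_lt_trans; apply: le_measure; rewrite ?inE//; exact: measurable_box.
Qed.

(** A singleton of R^(n+1) is a product whose first factor is a null singleton
    of the line. *)
Lemma lebesgue_rV_set1 n (x : 'rV[R]_n) : (0 < n)%N ->
  measurable [set x] /\ lebesgue_rV n [set x] = 0%E.
Proof.
have m1 m (y : 'rV[R]_m) : measurable [set y].
  rewrite (_ : [set y] = \bigcap_(i in [set: 'I_m])
      ((fun v : 'rV[R]_m => v 0 i) @^-1` [set y 0 i])).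
    apply: fin_bigcap_measurable => // i _.
    by rewrite -[X in measurable X]setTI; exact: measurable_coor.
  apply/seteqP; split=> [v -> //|v vy]; apply/rowP => i; exact: vy.
case: n x => // n x _; split => //.
rewrite /= /lebesgue_step /pushforward.
rewrite (_ : _ @^-1` _ = [set (split_rV x).1] `*` [set (split_rV x).2]).
  rewrite product_measure1E//; last exact: m1.
  rewrite [X in (X * _)%E](_ : _ = 0%E) ?mul0e//.
  exact: lebesgue_measure_set1.
apply/seteqP; split=> [p px|[p1 p2] [/= -> ->]].
  have {}px : cons_rV p = x := px.
  by have := cons_rVK p; rewrite px => ->.
rewrite /cons_rV /=; apply/rowP => i.
have [j ->|->] := unliftP ord0 i.
  have -> : lift ord0 j = rshift 1 j by apply/val_inj.
  by rewrite (row_mxEr (m:=1)(n1:=1)) mxE.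
have -> : ord0 = lshift n (ord0 : 'I_1) by exact/val_inj.
by rewrite (row_mxEl (m:=1)(n1:=1)) mxE eqxx mulr1n.
Qed.

End boxes.

(** * Smooth cutoff functions *)

Section flat.
Context {R : realType}.
Implicit Types (p : {poly R}) (t : R).

(** With [p = 1] this is the classical smooth function that is flat at 0. The
    polynomial factor in 1/t makes the family stable under derivation. *)
Definition flat p t : R := if 0 < t then p.[t^-1] * expR (- t^-1) else 0.

Lemma flat_le0 p t : t <= 0 -> flat p t = 0.
Proof. by rewrite /flat leNgt => /negbTE ->. Qed.

(** One term of the exponential series is below its sum. *)
Lemma ler_exprn_expR n t : 0 <= t -> t ^+ n <= n`!%:R * expR t.
Proof.
case: n => [|n] t0; first by rewrite expr0 mul1r -expR0 ler_expR.
have := expR_ge1Dxn n t0; have f0 : 0 < (n.+1)`!%:R :> R by rewrite ltr0n fact_gt0.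
by rewrite -ler_pdivrMl// mulrC => /(le_trans _) -> //; rewrite lerDr.
Qed.

Lemma horner_le_expR p : exists2 C, 0 <= C & forall t, 0 <= t -> `|p.[t]| <= C * expR t.
Proof.
exists (\sum_(i < size p) `|p`_i| * i`!%:R); first by rewrite sumr_ge0.
move=> t t0; rewrite horner_coef (le_trans (ler_norm_sum _ _ _))// mulr_suml.
apply: ler_sum => i _; rewrite normrM -mulrA ler_wpM2l// ger0_norm ?exprn_ge0//.
exact: ler_exprn_expR.
Qed.

(** The exponential beats every polynomial in 1/t. The power 2 is what makes
    the difference quotient at 0 tend to 0. *)
Lemma flat_sqr p : exists2 C, 0 <= C & forall t, `|flat p t| <= C * t ^+ 2.
Proof.
have [C C0 HC] := horner_le_expR (p * 'X^2); exists C => // t.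
rewrite /flat; case: ifPn => [t0|_]; last by rewrite normr0 mulr_ge0 ?sqr_ge0.
have := HC t^-1; rewrite invr_ge0 (ltW t0) => /(_ isT).
rewrite hornerM hornerXn normrM (ger0_norm (sqr_ge0 _)) normrM (ger0_norm (expR_ge0 _)) expRN.
rewrite ler_pdivrMr ?expR_gt0//.
by rewrite exprVn ler_pdivrMr ?exprn_gt0// mulrAC.
Qed.

Lemma is_derive_comp1 (f g : R -> R) (x a b : R) :
  is_derive (g x) 1 f a -> is_derive x 1 g b -> is_derive x 1 (fun y => f (g y)) (a * b).
Proof.
move=> [df <-] [dg <-]; have := derive1_comp dg df; rewrite !derive1E => <-.
have dfg : derivable (f \o g) x 1.
  by apply/derivable1_diffP/differentiable_comp; exact/derivable1_diffP.
exact: (DeriveDef dfg erefl).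
Qed.

(** For t > 0 the derivative of p(1/t) exp(-1/t) is
    (p(1/t) - p'(1/t)) t^-2 exp(-1/t), again of the same shape. *)
Lemma is_derive_flat p t : is_derive t 1 (flat p) (flat ('X^2 * (p - p^`())) t).
Proof.
have [t0|t0|->] := ltgtP t 0.
- rewrite flat_le0; last exact: ltW.
  apply: (near_eq_is_derive (f := cst 0)).
  near=> s; rewrite flat_le0//; apply: ltW; near: s.
  by apply: lt_nbhsl.
- have t0' : t != 0 by rewrite gt_eqF.
  have Dinv : is_derive t 1 (fun s : R => s^-1) (- t^-1 ^+ 2).
    apply: is_derive_eq; first exact: (is_deriveV (f := id) t0').
    by rewrite /= exprVn /GRing.scale /= mulr1.
  have Dneg : is_derive t 1 (fun s : R => - s^-1) (t^-1 ^+ 2).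
    by have := is_deriveN Dinv; rewrite opprK.
  have Dexp := @is_derive_comp1 expR (fun s => - s^-1) t _ _ (is_derive_expR (- t^-1)) Dneg.
  have Dp := @is_derive_comp1 (horner p) (fun s => s^-1) t _ _ (is_derive_poly p t^-1) Dinv.
  have Dg : is_derive t 1 (fun s : R => p.[s^-1] * expR (- s^-1))
      (flat ('X^2 * (p - p^`())) t).
    have DM := is_deriveM Dp Dexp; apply: (is_derive_eq DM).
    rewrite /flat t0 !hornerE /GRing.scale /=; ring.
  apply: near_eq_is_derive Dg.
  by near=> s; rewrite /flat ifT//; near: s; exact: lt_nbhsr.
- have [C C0 HC] := flat_sqr p; rewrite flat_le0//.
  set q := fun h => h^-1 *: ((flat p \o shift 0) (h *: 1) - flat p 0).
  have qE h : q h = h^-1 * flat p h.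
    by rewrite /q /= addr0 (flat_le0 p (lexx 0)) subr0 [h *: 1]mulr1.
  suff cq : q h @[h --> 0^'] --> (0 : R).
    by apply: DeriveDef; [apply/cvg_ex; exists 0|exact/cvg_lim].
  have Cc : C * `|h| @[h --> (0 : R)^'] --> (0 : R).
    have Cn : `|h| @[h --> (0 : R)^'] --> `|0 : R|.
      by apply: cvg_norm; exact: nbhs_dnbhs.
    by have := cvgMl_tmp (a := C) Cn; rewrite normr0 mulr0; apply.
  apply: (@squeeze_cvgr _ _ _ _ (fun h => - (C * `|h|)) (fun h => C * `|h|)).
  - near=> h; rewrite -ler_norml qE.
    rewrite normrM normfV ler_pdivrMl; last first.
      by rewrite normr_gt0; near: h; exact: nbhs_dnbhs_neq.
    by rewrite (le_trans (HC h))// -[h ^+ 2]real_normK ?num_real// expr2 mulrCA.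
  - by have := cvgN Cc; rewrite oppr0; apply.
  - exact: Cc.
Unshelve. all: by end_near. Qed.
End flat.

Section directional.
Context {R : realType} {d : nat}.
Lemma is_derive_coor (g : R -> R) (x : 'rV[R]_d) (i j : 'I_d) dg :
  is_derive (x 0 j) 1 g dg ->
  is_derive x (delta_mx 0 i) (fun y : 'rV[R]_d => g (y 0 j)) (if i == j then dg else 0).
Proof.
move=> Dg; pose q h := h^-1 *: ((g \o shift (x 0 j)) (h *: 1) - g (x 0 j)).
have cq : q h @[h --> 0^'] --> dg.
  by case: Dg => Dg <-.
have DQ : (fun h => h^-1 *: (((fun y : 'rV[R]_d => g (y 0 j)) \o shift x)
    (h *: delta_mx 0 i) - g (x 0 j))) = if i == j then q else fun=> 0.
  apply/funext => h; rewrite /= !mxE eqxx /= (eq_sym j); case: (i == j).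
    by rewrite /q /= [h *: _]mulr1 mulr1.
  by rewrite mulr0 add0r subrr scaler0.
have cQ : (fun h => h^-1 *: (((fun y : 'rV[R]_d => g (y 0 j)) \o shift x)
    (h *: delta_mx 0 i) - g (x 0 j))) @ 0^' --> (if i == j then dg else 0).
  by rewrite DQ; case: ifP => // _; exact: cvg_cst.
by apply: DeriveDef; [apply/cvg_ex; exists (if i == j then dg else 0)|exact/cvg_lim].
Qed.

(** An algebra of functions stable under all partial derivatives, so that
    membership alone yields infinite differentiability. The affine change of
    variable in the atoms places the flat point at any hyperplane, facing either
    side. *)
Inductive flat_algebra : ('rV[R]_d -> R) -> Prop :=
| flat_atom p j c s : flat_algebra (fun x => flat p (c * (x 0 j - s)))
| flat_cst a : flat_algebra (fun=> a)
| flat_add f g : flat_algebra f -> flat_algebra g -> flat_algebra (fun x => f x + g x)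
| flat_mul f g : flat_algebra f -> flat_algebra g -> flat_algebra (fun x => f x * g x).

Lemma flat_algebra_derive f i : flat_algebra f ->
  exists2 f', flat_algebra f' & forall x, is_derive x (delta_mx 0 i) f (f' x).
Proof.
elim=> [p j c s|a|f1 f2 _ [g1 F1 D1] _ [g2 F2 D2]|f1 f2 F1' [g1 F1 D1] F2' [g2 F2 D2]].
- pose p' := 'X^2 * (p - p^`()).
  exists (fun x => (if i == j then c else 0) * flat p' (c * (x 0 j - s))).
    by apply: flat_mul; [exact: flat_cst|exact: flat_atom].
  move=> x; have Daff : is_derive (x 0 j) 1 (fun t : R => c * (t - s)) c.
    have DM := is_deriveZ c (is_deriveB (is_derive_id (x 0 j) 1) (is_derive_cst s (x 0 j) 1)).
    by apply: (is_derive_eq DM); rewrite subr0 /GRing.scale /= mulr1.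
  have Dc := @is_derive_comp1 _ (flat p) (fun t => c * (t - s)) (x 0 j) _ _
    (is_derive_flat p _) Daff.
  apply: (is_derive_eq (is_derive_coor i Dc)).
  by case: ifP; rewrite ?mul0r// mulrC.
- by exists (fun=> 0); [exact: flat_cst|move=> x; exact: is_derive_cst].
- exists (fun x => g1 x + g2 x); first exact: flat_add.
  by move=> x; exact: (is_deriveD (D1 x) (D2 x)).
- exists (fun x => f1 x * g2 x + f2 x * g1 x); first by apply: flat_add; exact: flat_mul.
  by move=> x; exact: (is_deriveM (D1 x) (D2 x)).
Qed.

Lemma flat_algebra_continuous f : flat_algebra f -> continuous f.
Proof.
elim=> [p j c s|a|f1 f2 _ c1 _ c2|f1 f2 _ c1 _ c2] x.
- have Dc := is_derive_flat p (c * (x 0 j - s)).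
  have /derivable1_diffP/differentiable_continuous cf : derivable (flat p) (c * (x 0 j - s)) 1.
    by case: Dc.
  have cA : c * (y 0 j - s) @[y --> x] --> c * (x 0 j - s).
    exact: cvgMl_tmp (cvgB (@coord_continuous R 1 d 0 j x) (cvg_cst s)).
  exact: cvg_comp cA cf.
- exact: cst_continuous.
- exact: (cvgD (c1 x) (c2 x)).
- exact: (cvgM (c1 x) (c2 x)).
Qed.

(** Induction on the order of differentiation; the statement for all members at
    once is what lets it apply to the partial derivatives. *)
Lemma flat_algebra_Ck f m : flat_algebra f -> Ck m f.
Proof.
elim: m f => [|m IH] f Ff; (split; first exact: flat_algebra_continuous) => // i.
have [f' Ff' Df] := flat_algebra_derive i Ff; split; first by move=> x; case: (Df x).
rewrite (_ : partial i f = f'); first exact: IH.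
by apply/funext => x; case: (Df x).
Qed.

Lemma flat_algebra_prod (I : finType) (F : I -> 'rV[R]_d -> R) :
  (forall i, flat_algebra (F i)) -> flat_algebra (fun x => \prod_i F i x).
Proof.
move=> FF; elim: (index_enum I) => [|i s IH].
  by rewrite (_ : (fun _ => _) = fun=> 1); [exact: flat_cst|apply/funext => x; rewrite big_nil].
rewrite (_ : (fun _ => _) = fun x => F i x * \prod_(j <- s) F j x).
  exact: flat_mul.
by apply/funext => x; rewrite big_cons.
Qed.

(** As [m] grows these functions tend to the indicator of the open box, because
    exp(-1/(m t)) tends to 1 for t > 0 while [flat] vanishes for t <= 0. *)
Definition cutoff (a b : 'I_d -> R) (m : nat) (x : 'rV[R]_d) : R :=
  \prod_i (flat 1 (m.+1%:R * (x 0 i - a i)) * flat 1 (- m.+1%:R * (x 0 i - b i))).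

Lemma flat1_01 (t : R) : 0 <= flat 1 t <= 1.
Proof.
rewrite /flat; case: ifPn => [t0|_]; last by rewrite lexx ler01.
rewrite hornerE mul1r expR_ge0 /= -expR0 ler_expR oppr_le0 invr_ge0; exact: ltW.
Qed.

Lemma cutoff_01 a b m x : 0 <= cutoff a b m x <= 1.
Proof.
have F01 i : 0 <= flat 1 (m.+1%:R * (x 0 i - a i)) *
                  flat 1 (- m.+1%:R * (x 0 i - b i)) <= 1.
  have /andP[? ?] := flat1_01 (m.+1%:R * (x 0 i - a i)).
  have /andP[? ?] := flat1_01 (- m.+1%:R * (x 0 i - b i)).
  by rewrite mulr_ge0//= mulr_ile1.
apply/andP; split; first by apply: prodr_ge0 => i _; case/andP: (F01 i).
by apply: prodr_ile1 => i _; exact: F01.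
Qed.

Lemma cutoff_out a b m x : ~ box a b x -> cutoff a b m x = 0.
Proof.
move=> /existsNP[i /negP]; rewrite negb_and -!leNgt => xab.
rewrite /cutoff (bigD1 i)//=; case/orP: xab => h.
  by rewrite [flat _ (_ * (_ - a i))]flat_le0 ?mul0r// mulr_ge0_le0// subr_le0.
rewrite [flat _ (_ * (_ - b i))]flat_le0 ?mulr0 ?mul0r//.
by rewrite mulr_le0_ge0 ?subr_ge0 ?oppr_le0.
Qed.

Lemma flat1_cvg (t : R) : 0 < t -> flat 1 (m.+1%:R * t) @[m --> \oo] --> (1 : R).
Proof.
move=> t0; rewrite (_ : (fun _ => _) = fun m => expR (- (m.+1%:R^-1 * t^-1))).
  have hN : - (m.+1%:R^-1 * t^-1) @[m --> \oo] --> (0 : R).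
    by have := cvgN (cvgMr_tmp (b := t^-1) (@cvg_harmonic R)); rewrite mul0r oppr0; apply.
  have := cvg_comp _ _ hN (@continuous_expR R 0).
  by rewrite expR0; apply.
by apply/funext => m; rewrite /flat mulr_gt0 ?ltr0n// hornerE mul1r invfM.
Qed.

Lemma cutoff_cvg a b x : box a b x -> cutoff a b ^~ x @ \oo --> (1 : R).
Proof.
move=> xab; rewrite /cutoff; elim: (index_enum _) => [|i s IH].
  by under eq_fun do rewrite big_nil; exact: cvg_cst.
under eq_fun do rewrite big_cons.
have /andP[axi xbi] := xab i.
have axi' : 0 < x 0 i - a i by rewrite subr_gt0.
have xbi' : 0 < b i - x 0 i by rewrite subr_gt0.
have := cvgM (cvgM (flat1_cvg axi') (flat1_cvg xbi')) IH.
rewrite !mul1r => cF.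
rewrite (_ : (fun m => _) = fun m => flat 1 (m.+1%:R * (x 0 i - a i)) *
  flat 1 (m.+1%:R * (b i - x 0 i)) * \prod_(j <- s) (flat 1 (m.+1%:R * (x 0 j - a j)) *
    flat 1 (- m.+1%:R * (x 0 j - b j)))); first exact: cF.
by apply/funext => m; rewrite mulNr -mulrN opprB.
Qed.

Lemma compact_cbox (a b : 'I_d -> R) : compact (cbox a b).
Proof.
have := @rV_compact R d (fun i => `[a i, b i]%classic) (fun i => @segment_compact R _ _).
by rewrite (_ : [set v | _] = cbox a b).
Qed.

Lemma cutoff_test_function (E : set 'rV[R]_d) a b m : cbox a b `<=` E ->
  test_function E (cutoff a b m).
Proof.
move=> abE.
have supp : closure [set x | cutoff a b m x != 0] `<=` cbox a b.
  have clo : closed (cbox a b).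
    by apply: compact_closed; [exact: norm_hausdorff|exact: compact_cbox].
  rewrite closureE; apply: smallest_sub => // x /eqP bx.
  by apply: box_sub_cbox; apply: contrapT => /(cutoff_out m)/bx.
split; last exact: subset_trans supp abE.
- move=> k; apply: flat_algebra_Ck; apply: flat_algebra_prod => i.
  by apply: flat_mul; exact: flat_atom.
- exact: subclosed_compact (@closed_closure _ _) (@compact_cbox a b) supp.
Qed.
End directional.

(** * Square-integrable functions *)

Section square_integrable.
Context {R : realType} {d : nat}.
Local Notation X := 'rV[R]_d.
Local Notation lam := (@lebesgue_rV R d).
Implicit Types (E : set X) (u v w : X -> R).

Definition integrable_on E v := lam.-integrable E (EFin \o v).

(** Trades the L^2 norm for a plain integral of the square. *)
Lemma L2P E v : measurable E ->
  L2 E v <-> measurable_fun E v /\ integrable_on E (fun x => v x ^+ 2).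
Proof.
move=> mE.
have sqE : EFin \o (fun x => (v \_ E) x ^+ 2) = (EFin \o (fun x => v x ^+ 2)) \_ E.
  by apply/funext => x; rewrite /patch /=; case: ifP => //; rewrite expr0n.
split=> [v2|[mv iv]].
  have := v2; rewrite /L2 inE => /andP[/[!inE] /= mv _]; split.
    exact/(measurable_restrictT _ mE).
  by apply/integrable_mkcond => //; rewrite -sqE; exact: Lfun2_integrable_sqr.
rewrite /L2 inE; apply/andP; split; rewrite inE /=.
  exact/(measurable_restrictT _ mE).
rewrite /finite_norm unlock /Lnorm; apply: poweR_lty.
move/integrable_mkcond : iv => /(_ mE); rewrite -sqE => /integrableP[_].
apply: le_lt_trans; rewrite le_eqVlt; apply/orP; left; apply/eqP.
by apply: eq_integral => x _ /=; rewrite powR_mulrn// real_normK ?num_real// ger0_norm ?sqr_ge0.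
Qed.

Lemma L2_measurable E v : measurable E -> L2 E v -> measurable_fun E v.
Proof. by move=> mE /(L2P _ mE)[]. Qed.

Lemma integrable_on_aeeq E u v : measurable E -> measurable_fun E v ->
  aeeq E u v -> integrable_on E u -> integrable_on E v.
Proof.
move=> mE mv uv /integrableP[mu iu]; apply/integrableP; split.
  exact/measurable_EFinP.
rewrite (@ge0_ae_eq_integral _ _ _ _ E _ (fun x => `|(EFin \o u) x|%E))//.
- by apply: measurableT_comp => //; exact/measurable_EFinP.
- exact: measurableT_comp.
- by apply: filterS uv => x /[apply] /= ->.
Qed.

Lemma integrable_on_le E u v : measurable E -> measurable_fun E u ->
  (forall x, E x -> `|u x| <= v x) -> integrable_on E v -> integrable_on E u.
Proof.
move=> mE mu uv; apply: le_integrable => //; first exact/measurable_EFinP.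
by move=> x Ex /=; rewrite lee_fin (le_trans (uv x Ex))// ler_norm.
Qed.

Lemma integrable_onD E u v : measurable E -> integrable_on E u -> integrable_on E v ->
  integrable_on E (fun x => u x + v x).
Proof. by move=> mE iu iv; rewrite /integrable_on; exact: (integrableD mE iu iv). Qed.

Lemma integrable_onZ E a u : measurable E -> integrable_on E u ->
  integrable_on E (fun x => a * u x).
Proof. by move=> mE iu; exact: (integrableZl mE a iu). Qed.

Lemma integrable_on_sum (I : Type) (s : seq I) E (F : I -> X -> R) : measurable E ->
  (forall i, integrable_on E (F i)) -> integrable_on E (fun x => \sum_(i <- s) F i x).
Proof.
move=> mE iF; elim: s => [|i s IH].
  by under eq_fun do rewrite big_nil; exact: integrable0.
by under eq_fun do rewrite big_cons; exact: integrable_onD.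
Qed.

(** The product is dominated by the sum of the squares. *)
Lemma L2_mul_integrable E u v : measurable E -> L2 E u -> L2 E v ->
  integrable_on E (fun x => u x * v x).
Proof.
move=> mE /(L2P _ mE)[mu iu] /(L2P _ mE)[mv iv].
apply: integrable_on_le (integrable_onD mE iu iv) => //.
  exact: measurable_funM.
move=> x _; rewrite ler_norml; have := sqr_ge0 (u x + v x).
have := sqr_ge0 (u x - v x); have := sqr_ge0 (u x); have := sqr_ge0 (v x).
by move=> ? ? ? ?; apply/andP; split; nra.
Qed.

Lemma L2_lin E a u v : measurable E -> L2 E u -> L2 E v ->
  L2 E (fun x => a * u x + v x).
Proof.
move=> mE u2 v2; have [mu iu] := (L2P _ mE).1 u2; have [mv iv] := (L2P _ mE).1 v2.
apply/L2P => //; split; first by apply: measurable_funD => //; exact: measurable_funM.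
rewrite (_ : (fun _ => _) = fun x => a ^+ 2 * u x ^+ 2 + ((2 * a) * (u x * v x) + v x ^+ 2)).
  apply: integrable_onD => //; first exact: integrable_onZ.
  apply: integrable_onD => //; apply: integrable_onZ => //; exact: L2_mul_integrable.
by apply/funext => x; ring.
Qed.

Lemma L2_sub E u v : measurable E -> L2 E u -> L2 E v -> L2 E (u \- v).
Proof.
move=> mE u2 v2; rewrite (_ : u \- v = fun x => -1 * v x + u x); first exact: L2_lin.
by apply/funext => x /=; ring.
Qed.

Lemma L2_S E F v : measurable E -> measurable F -> E `<=` F -> L2 F v -> L2 E v.
Proof.
move=> mE mF EF /(L2P _ mF)[mv iv]; apply/L2P => //; split.
  exact: measurable_funS mv.
exact: integrableS iv.
Qed.

(** The bound on [w] holds only almost everywhere, so [w] is first truncated to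
    obtain a pointwise domination. *)
Lemma L2_bounded_mul E u w (K : R) : measurable E -> L2 E u -> measurable_fun E w ->
  {ae lam, forall x, E x -> `|w x| <= K} -> L2 E (fun x => w x * u x).
Proof.
move=> mE u2 mw wK; have [mu iu] := (L2P _ mE).1 u2.
have mwu : measurable_fun E (fun x => w x * u x) by exact: measurable_funM.
apply/L2P => //; split => //.
pose t x : R := Num.max (- `|K|) (Num.min `|K| (w x)).
have tK x : `|t x| <= `|K|.
  rewrite ler_norml /t le_max lexx /= ge_max ge_min lexx /= andbT.
  by rewrite (le_trans _ (normr_ge0 K))// oppr_le0.
have mt : measurable_fun E t.
  apply: measurable_maxr; first exact: measurable_cst.
  by apply: measurable_minr => //; exact: measurable_cst.
apply: (integrable_on_aeeq (u := fun x => (t x * u x) ^+ 2)) => //.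
- by apply: measurable_funX.
- apply: filterS wK => x wK Ex; congr ((_ * _) ^+ 2).
  have := wK Ex; have := ler_norm K; rewrite ler_norml /t => KK /andP[w1 w2].
  by rewrite min_r ?max_r//; lra.
- apply: integrable_on_le (integrable_onZ (`|K| ^+ 2) mE iu) => //.
    by apply: measurable_funX; exact: measurable_funM.
  move=> x Ex; rewrite normrX normrM exprMn -[u x ^+ 2]real_normK ?num_real//.
  by rewrite ler_wpM2r ?sqr_ge0// lerXn2r// nnegrE.
Qed.

Lemma L2_cst E (a : R) : measurable E -> (lam E < +oo)%E -> L2 E (fun=> a).
Proof.
move=> mE Eoo; apply/L2P => //; split; first exact: measurable_cst.
apply/integrableP; split; first exact: measurable_cst.
by rewrite /= integral_cst// lte_mul_pinfty// lee_fin.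
Qed.

Lemma L2_bounded E w (K : R) : measurable E -> (lam E < +oo)%E -> measurable_fun E w ->
  {ae lam, forall x, E x -> `|w x| <= K} -> L2 E w.
Proof.
move=> mE Eoo mw wK; rewrite (_ : w = fun x => w x * 1).
  exact: L2_bounded_mul (L2_cst _ mE Eoo) mw wK.
by apply/funext => x; rewrite mulr1.
Qed.

Lemma L2_integrable E u : measurable E -> (lam E < +oo)%E -> L2 E u -> integrable_on E u.
Proof.
move=> mE Eoo u2; have := L2_mul_integrable mE u2 (L2_cst 1 mE Eoo).
by congr integrable_on; apply/funext => x; rewrite mulr1.
Qed.

Lemma Linf_bound E w : measurable E -> Linf E w ->
  exists2 K : R, 0 <= K & measurable_fun E w /\ {ae lam, forall x, E x -> `|w x| <= K}.
Proof.
move=> mE; rewrite /Linf inE => /andP[/[!inE] /= mw].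
rewrite /finite_norm unlock /Lnorm => wy.
have {}mw : measurable_fun E w by exact/(measurable_restrictT _ mE).
have wb K : {ae lam, forall x, `|(w \_ E) x| <= K} -> {ae lam, forall x, E x -> `|w x| <= `|K| }.
  apply: filterS => x wK Ex; move: wK; rewrite /patch mem_set// => /le_trans; apply.
  exact: ler_norm.
case: ifPn wy => [T0 /ess_supr_bounded[K wK]|T0 _].
  by exists `|K|; rewrite ?normr_ge0//; split => //; exact: wb.
exists 0 => //; split => //.
have T00 : lam setT = 0%E.
  by apply/eqP; rewrite eq_le measure_ge0 andbT leNgt.
by exists setT; split => //.
Qed.

Lemma Rintegral_aeeq E u v : measurable E -> measurable_fun E u -> measurable_fun E v ->
  aeeq E u v -> \int[lam]_(x in E) u x = \int[lam]_(x in E) v x.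
Proof.
move=> mE mu mv uv; congr fine; apply: ae_eq_integral => //; [exact/measurable_EFinP..|].
by apply: filterS uv => x /[apply] ->.
Qed.

Lemma Rintegral0 E u : measurable E -> (forall x, u x = 0) -> \int[lam]_(x in E) u x = 0.
Proof.
by move=> mE u0; rewrite (@eq_Rintegral _ _ _ lam E (fun=> 0)) ?Rintegral_cst ?mul0r.
Qed.

Lemma Rintegral_sum (I : finType) E (F : I -> X -> R) : measurable E ->
  (forall i, integrable_on E (F i)) ->
  \int[lam]_(x in E) (\sum_i F i x) = \sum_i \int[lam]_(x in E) F i x.
Proof.
move=> mE iF; elim: (index_enum I) => [|i s IH].
  by rewrite big_nil Rintegral0// => x; rewrite big_nil.
rewrite big_cons -IH -RintegralD//; [|exact: iF|exact: integrable_on_sum].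
by apply: eq_Rintegral => x _; rewrite big_cons.
Qed.

End square_integrable.

(** * The fundamental lemma of the calculus of variations *)

Section fundamental_lemma.
Context {R : realType} {d : nat}.
Local Notation X := 'rV[R]_d.
Local Notation lam := (@lebesgue_rV R d).
Implicit Types (E : set X) (g : X -> R).

Lemma cutoff_measurable (a b : 'I_d -> R) m : measurable_fun setT (cutoff a b m).
Proof.
apply: continuous_measurable_rV.
have [Ckb _ _] := cutoff_test_function m (@subset_refl _ (cbox a b)).
by case: (Ckb 0%N).
Qed.

(** Dominated convergence along the cutoff functions of the box. *)
Lemma integral_box_eq0 E g (a b : 'I_d -> R) : measurable E -> integrable_on E g ->
  (forall phi, test_function E phi -> \int[lam]_(x in E) (g x * phi x) = 0) ->
  cbox a b `<=` E -> (\int[lam]_(x in box a b) (g x)%:E = 0)%E.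
Proof.
move=> mE ig gphi abE.
have mg : measurable_fun E g by case/integrableP : ig => /measurable_EFinP.
have mB m : measurable_fun E (cutoff a b m).
  by apply: measurable_funTS; exact: cutoff_measurable.
have ifm m : integrable_on E (fun x => g x * cutoff a b m x).
  apply: (@integrable_on_le _ _ _ _ (fun x => `|g x|)) => //.
  - exact: measurable_funM.
  - move=> x _; rewrite normrM ler_piMr//.
    by have /andP[b0 b1] := cutoff_01 a b m x; rewrite ger0_norm.
  - exact: integrable_norm.
have [] := @dominated_convergence _ _ _ lam E mE
  (fun m x => (g x * cutoff a b m x)%:E) (((EFin \o g) \_ (box a b))) (fun x => `|g x|%:E).
- by move=> m; apply/measurable_EFinP; exact: measurable_funM.
- apply/measurable_restrict => //; first exact: measurable_box.
  apply/measurable_EFinP; exact: measurable_funS mg.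
- apply: aeW => x Ex; rewrite /patch; case: ifPn => [/set_mem xB|/negP xB].
    apply: cvg_EFin; first exact: nearW.
    by have := cvgMl_tmp (a := g x) (cutoff_cvg xB); rewrite mulr1; apply.
  have b0 m : cutoff a b m x = 0 by apply: cutoff_out => Bx; apply: xB; rewrite inE.
  by under eq_fun do rewrite b0 mulr0; exact: cvg_cst.
- exact: integrable_norm.
- apply: aeW => x m _ /=; rewrite lee_fin normrM ler_piMr//.
  by have /andP[b0 b1] := cutoff_01 a b m x; rewrite ger0_norm.
move=> _ _.
have -> : (fun m : nat => (\int[lam]_(x in E) (g x * cutoff a b m x)%:E)%E) = cst 0%E.
  apply/funext => m.
  have := gphi _ (cutoff_test_function m abE).
  rewrite /Rintegral -[RHS]/(fine 0%E) => h.
  by rewrite -[LHS]fineK ?h//; exact: integrable_fin_num (ifm m).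
move=> /(cvg_lim (@ereal_hausdorff R)); rewrite lim_cst; last exact: ereal_hausdorff.
rewrite -integral_mkcondr setIidr//.
exact: subset_trans (@box_sub_cbox _ _ _ _) abE.
Qed.

(** A pi-system generating the measurable sets, each of which meets a fixed box
    in a box with the same upper corner, so with closure in the same open set. *)
Definition orthants : set (set X) := [set [set x : X | forall i, a i < x 0 i] | a in setT].

Lemma measurable_orthants : @measurable _ X = <<s orthants >>.
Proof.
apply/seteqP; split; last first.
  apply: smallest_sub; first exact: sigma_algebra_measurable.
  move=> _ [a _ <-].
  rewrite (_ : [set x | _] = \bigcap_(i in [set: 'I_d])
      ((fun v : X => v 0 i) @^-1` `]a i, +oo[)).
    apply: fin_bigcap_measurable => // i _.
    by rewrite -[X in measurable X]setTI; exact: measurable_coor.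
  apply/seteqP; split=> x /= xa i => [_|]; first by rewrite /= in_itv /= xa.
  by have := xa i I; rewrite /= in_itv /= andbT.
apply: smallest_sub; first exact: smallest_sigma_algebra.
rewrite -bigcup_seq; apply: bigcup_sub => i _.
pose T := g_sigma_algebraType orthants.
suff mi : measurable_fun [set: T] (fun v : T => (v : X) 0 i).
  by move=> _ [Y mY <-]; exact: mi.
apply: (measurability _ (RGenOInfty.measurableE R)) => _ [_ [t ->] <-].
rewrite setTI (_ : _ @^-1` _ = \bigcup_k
  [set x : X | forall j, (if j == i then t else - k%:R) < x 0 j]).
  apply: bigcupT_measurable => k; apply: sub_sigma_algebra.
  by exists (fun j => if j == i then t else - k%:R).
apply/seteqP; split=> [x /=|x [k _ /(_ i)]]; rewrite /= in_itv /= andbT ?eqxx// => tx.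
exists (Num.truncn `|x|).+1 => // j /=; case: eqP => [->//|_].
have := ler_coor_norm x j; rewrite ler_norml => /andP[+ _]; apply: lt_le_trans.
by rewrite ltrN2 truncnS_gt.
Qed.

(** It suffices to work in one box [Q] whose closure lies in [E], since
    countably many such boxes cover [E]. The sets [A] on which the integral of
    [g] over the intersection of [A] and [Q] vanishes form a lambda-system
    containing the orthants, hence contain all measurable sets. *)
Lemma test_functions_separate E g : open E -> integrable_on E g ->
  (forall phi, test_function E phi -> \int[lam]_(x in E) (g x * phi x) = 0) ->
  aeeq E g (fun=> 0).
Proof.
move=> oE ig gphi; have mE : measurable E by exact: open_measurable_rV.
suff ae_box a b : cbox a b `<=` E -> aeeq (box a b) g (fun=> 0).
  have [F [EF FP]] := open_bigcup_box oE.
  suff /ae_foralln : forall k, {ae lam, forall x, F k x -> g x = 0}.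
    by apply: filterS => x gF; rewrite EF => -[k _]; exact: gF.
  move=> k; have [->|[a [b [-> abE]]]] := FP k; first exact: aeW.
  exact: ae_box.
move=> abE; set Q := box a b; have mQ : measurable Q by exact: measurable_box.
have QE : Q `<=` E by exact: subset_trans (@box_sub_cbox _ _ _ _) abE.
have igQ : integrable_on Q g by exact: integrableS ig.
pose P (A : set X) := (\int[lam]_(x in A `&` Q) (g x)%:E = 0)%E.
have PQ : P setT by rewrite /P setTI; exact: integral_box_eq0 ig gphi abE.
have igA (A : set X) : measurable A -> integrable_on (A `&` Q) g.
  by move=> mA; apply: integrableS igQ => //; exact: measurableI.
have PG : orthants `<=` P.
  move=> _ [t _ <-]; rewrite /P (_ : _ `&` _ = box (fun i => Num.max (t i) (a i)) b).
    apply: integral_box_eq0 ig gphi _ => // x xb; apply: abE => i.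
    by have /andP[+ ->] := xb i; rewrite ge_max => /andP[_ ->].
  apply/seteqP; split=> [x [/= xt xQ] i|x xb].
    by rewrite gt_max xt /=; exact: xQ.
  by split=> i; have /andP[+ xbi] := xb i; rewrite gt_max => /andP[xt xa] //; rewrite xa.
have PA A : measurable A -> P A.
  rewrite measurable_orthants; apply: dynkin_induction => //.
  - exact: measurable_orthants.
  - move=> _ _ [s _ <-] [t _ <-]; exists (fun i => Num.max (s i) (t i)) => //.
    apply/seteqP; split=> x /=.
      by move=> xst; split=> i; have := xst i; rewrite gt_max => /andP[].
    by move=> [xs xt] i; rewrite gt_max xs xt.
  - move=> A' mA' PA'; rewrite /P.
    have QU : setT `&` Q = (A' `&` Q) `|` (~` A' `&` Q).
      by rewrite -setIUl setUv.
    have := PQ; rewrite /P QU integral_setU ?PA' ?add0e//.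
    + exact: measurableI.
    + by apply: measurableI => //; exact: measurableC.
    + rewrite -QU setTI; exact: measurable_int igQ.
    + by apply/disj_setPS => x [[Ax _] [nAx _]].
  - move=> F mF tF PF; rewrite /P setI_bigcupl integral_bigcup.
    + by rewrite eseries0// => k _ _; exact: PF.
    + exact: trivIset_setIr.
    + by move=> k; exact: measurableI.
    + by rewrite -setI_bigcupl; apply: igA; exact: bigcupT_measurable.
have : ae_eq lam Q (EFin \o g) (cst 0%E).
  apply: integral_ae_eq => // A AQ mA.
  by rewrite integral0; have := PA A mA; rewrite /P setIidl.
by apply: filterS => x /[apply] -[].
Qed.

End fundamental_lemma.

(** * Test functions *)

Section test_functions.
Context {R : realType} {d : nat}.
Local Notation X := 'rV[R]_d.
Local Notation lam := (@lebesgue_rV R d).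
Implicit Types (E : set X) (u v phi : X -> R).

Lemma continuous_compact_support_bounded (f : X -> R) (K : set X) :
  continuous f -> compact K -> (forall x, ~ K x -> f x = 0) ->
  exists C : R, forall x, `|f x| <= C.
Proof.
move=> cf cK fK.
have /compact_bounded[M [_ MP]] : compact (f @` K).
  by apply: continuous_compact => //; exact: continuous_subspaceT.
exists (`|M| + 1) => x; have [Kx|nKx] := pselect (K x).
  by apply: MP; [rewrite (le_lt_trans (ler_norm M))// ltrDl|exists x].
by rewrite fK// normr0 addr_ge0.
Qed.

Lemma test_function_outside E phi x : test_function E phi ->
  ~ closure [set x | phi x != 0] x ->
  phi x = 0 /\ forall i, partial i phi x = 0.
Proof.
move=> _ nx.
have near0 : \near x, phi x = 0.
  have oC : open (~` closure [set x | phi x != 0]).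
    by apply: closed_openC; exact: closed_closure.
  apply: filterS (open_nbhs_nbhs (conj oC nx)) => y ny.
  by apply: contrapT => /eqP phiy; apply: ny; exact: subset_closure.
split; first exact: nbhs_singleton near0.
move=> i; rewrite /partial (@near_eq_derive _ _ _ phi (cst 0)) ?derive_cst//.
Qed.

Lemma test_function_L2 E F phi : measurable F -> (lam F < +oo)%E ->
  test_function E phi -> L2 F phi /\ forall i, L2 F (partial i phi).
Proof.
move=> mF Foo tphi; have [Ckphi cK _] := tphi.
have L2c f : continuous f -> (forall x, ~ closure [set x | phi x != 0] x -> f x = 0) -> L2 F f.
  move=> cf f0; have [C fC] := continuous_compact_support_bounded cf cK f0.
  apply: (L2_bounded (K := C)) => //; last exact: aeW.
  by apply: measurable_funTS; exact: continuous_measurable_rV.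
split; first by apply: L2c; [case: (Ckphi 0%N)|move=> x /(test_function_outside tphi)[]].
move=> i; apply: L2c; last by move=> x /(test_function_outside tphi)[_].
by have [_ /(_ i)[_ []]] := Ckphi 1%N.
Qed.

Lemma test_function_S E F phi : E `<=` F -> test_function E phi -> test_function F phi.
Proof. by move=> EF [? ? supp]; split => //; exact: subset_trans supp EF. Qed.

End test_functions.

(** * Weak gradients *)

Section weak_gradient.
Context {R : realType} {d : nat}.
Local Notation X := 'rV[R]_d.
Local Notation lam := (@lebesgue_rV R d).
Implicit Types (E : set X) (u v : X -> R) (g : X -> X).

Lemma is_wgrad_lin E a u v g h : measurable E -> (lam E < +oo)%E ->
  L2 E u -> L2 E v -> is_wgrad E u g -> is_wgrad E v h ->
  is_wgrad E (fun x => a * u x + v x) (fun x => a *: g x + h x).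
Proof.
move=> mE Eoo u2 v2 [g2 ug] [h2 vh]; split.
  move=> i; rewrite (_ : (fun _ => _) = fun x => a * g x 0 i + h x 0 i).
    exact: L2_lin.
  by apply/funext => x; rewrite !mxE.
move=> phi tphi i; have [phi2 dphi2] := test_function_L2 mE Eoo tphi.
have lin (f1 f2 p : X -> R) : L2 E f1 -> L2 E f2 -> L2 E p ->
    \int[lam]_(x in E) ((a * f1 x + f2 x) * p x) =
    a * \int[lam]_(x in E) (f1 x * p x) + \int[lam]_(x in E) (f2 x * p x).
  move=> f12 f22 p2; have i1 := L2_mul_integrable mE f12 p2.
  rewrite -RintegralZl// -RintegralD//; last exact: L2_mul_integrable.
    by apply: eq_Rintegral => x _; rewrite mulrDl mulrA.
  exact: integrable_onZ.
rewrite lin//.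
rewrite (_ : \int[lam]_(x in E) ((a *: g x + h x) 0 i * phi x) =
             \int[lam]_(x in E) ((a * g x 0 i + h x 0 i) * phi x)).
  by rewrite lin// ug// vh// opprD mulrN.
by apply: eq_Rintegral => x _; rewrite !mxE.
Qed.

(** The difference of two weak gradients is orthogonal to all test functions. *)
Lemma is_wgrad_unique E v g h i : open E -> (lam E < +oo)%E ->
  is_wgrad E v g -> is_wgrad E v h -> aeeq E (fun x => g x 0 i) (fun x => h x 0 i).
Proof.
move=> oE Eoo [g2 vg] [h2 vh]; have mE := open_measurable_rV oE.
have gh2 : L2 E (fun x => g x 0 i - h x 0 i) := L2_sub mE (g2 i) (h2 i).
have : aeeq E (fun x => g x 0 i - h x 0 i) (fun=> 0).
  apply: test_functions_separate => //; first exact: L2_integrable.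
  move=> phi tphi; have [phi2 _] := test_function_L2 mE Eoo tphi.
  have eqint := oppr_inj (etrans (esym (vg _ tphi i)) (vh _ tphi i)).
  rewrite (_ : (fun x => _) = fun x => g x 0 i * phi x - h x 0 i * phi x).
    by rewrite RintegralB ?eqint ?subrr//; exact: L2_mul_integrable.
  by apply/funext => x; rewrite mulrBl.
by apply: filterS => x /[apply] /eqP; rewrite subr_eq0 => /eqP.
Qed.

Lemma H1_wgrad E v : H1 E v -> is_wgrad E v (wgrad E v).
Proof.
case=> _ [g vg].
exact: (@xgetPex _ (fun=> 0) [set g | is_wgrad E v g] (ex_intro _ g vg)).
Qed.

Lemma is_wgrad_aeeq E u v g : measurable E -> measurable_fun E u -> measurable_fun E v ->
  (lam E < +oo)%E -> aeeq E u v -> is_wgrad E u g -> is_wgrad E v g.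
Proof.
move=> mE mu mv Eoo uv [g2 ug]; split => // phi tphi i; rewrite -ug//.
have [_ /(_ i) dphi2] := test_function_L2 mE Eoo tphi.
have mdphi := L2_measurable mE dphi2.
apply: Rintegral_aeeq => //; [exact: measurable_funM..|].
by apply: filterS uv => x /[apply] ->.
Qed.

Lemma aeeq_sym E u v : aeeq E u v -> aeeq E v u.
Proof. by apply: filterS => x /[apply]. Qed.

Lemma aeeq_trans E u v w : aeeq E u v -> aeeq E v w -> aeeq E u w.
Proof. by apply: filterS2 => x uv vw Ex; rewrite uv// vw. Qed.

Lemma aeeq_S E F u v : E `<=` F -> aeeq F u v -> aeeq E u v.
Proof. by move=> EF; apply: filterS => x uv Ex; apply: uv; exact: EF. Qed.

(** Functions equal almost everywhere have the same weak gradients, hence the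
    same chosen one: the equality is that of functions, not merely almost
    everywhere. *)
Lemma wgrad_aeeq E u v : measurable E -> measurable_fun E u -> measurable_fun E v ->
  (lam E < +oo)%E -> aeeq E u v -> wgrad E u = wgrad E v.
Proof.
move=> mE mu mv Eoo uv; rewrite /wgrad; congr xget.
apply/seteqP; split=> g /=; apply: is_wgrad_aeeq => //; exact: aeeq_sym.
Qed.

Lemma H1_aeeq E u v : measurable E -> (lam E < +oo)%E -> L2 E v ->
  aeeq E u v -> H1 E u -> H1 E v.
Proof.
move=> mE Eoo v2 uv [u2 [g ug]]; split => //; exists g.
by apply: is_wgrad_aeeq uv ug => //; exact: L2_measurable.
Qed.

Lemma H1_lin E a u v : measurable E -> (lam E < +oo)%E -> H1 E u -> H1 E v ->
  H1 E (fun x => a * u x + v x).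
Proof.
move=> mE Eoo [u2 [g ug]] [v2 [h vh]]; split; first exact: L2_lin.
by exists (fun x => a *: g x + h x); exact: is_wgrad_lin.
Qed.

(** A test function of the smaller set is one of the larger set, and all the
    integrands vanish off the smaller set. *)
Lemma H1_S E F v : measurable E -> measurable F -> E `<=` F -> H1 F v -> H1 E v.
Proof.
move=> mE mF EF [v2 [g [g2 vg]]]; split; first exact: L2_S v2.
exists g; split=> [i|phi tphi i]; first exact: L2_S (g2 i).
have tF := test_function_S EF tphi.
have [_ _ supp] := tphi.
have restrict (f p : X -> R) : (forall x, ~ E x -> p x = 0) ->
    \int[lam]_(x in E) (f x * p x) = \int[lam]_(x in F) (f x * p x).
  move=> p0; rewrite Rintegral_mkcond [RHS]Rintegral_mkcond.
  congr Rintegral; apply/funext => x; rewrite /patch.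
  have [Ex|nEx] := pselect (E x); first by rewrite (mem_set Ex) (mem_set (EF _ Ex)).
  by rewrite memNset// p0// mulr0; case: ifP.
by rewrite !restrict ?vg// => x nEx; case: (@test_function_outside _ _ _ _ x tphi) => // /supp.
Qed.

(** The function and its first weak derivatives, indexed together so that zero
    and first order terms of a bilinear form are treated alike. *)
Definition jet E u (a : option 'I_d) : X -> R :=
  if a is Some i then fun x => wgrad E u x 0 i else u.

Lemma jet_L2 E u a : H1 E u -> L2 E (jet E u a).
Proof. by move=> Hu; case: a => [i|]; [have [g2 _] := H1_wgrad Hu; exact: g2|case: Hu]. Qed.

Lemma jet_lin E c u v a : open E -> (lam E < +oo)%E -> H1 E u -> H1 E v ->
  aeeq E (jet E (fun x => c * u x + v x) a) (fun x => c * jet E u a x + jet E v a x).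
Proof.
move=> oE Eoo Hu Hv; have mE := open_measurable_rV oE.
case: a => [i|] /=; last exact: aeW.
have := is_wgrad_unique i oE Eoo (H1_wgrad (H1_lin c mE Eoo Hu Hv))
  (is_wgrad_lin c mE Eoo Hu.1 Hv.1 (H1_wgrad Hu) (H1_wgrad Hv)).
by apply: filterS => x /[apply] ->; rewrite !mxE.
Qed.

End weak_gradient.

(** * Semi-inner products *)

Section semi_inner_product.
Context {R : realType} {X : Type}.
Implicit Types (V : set (X -> R)) (B : (X -> R) -> (X -> R) -> R) (u v w : X -> R).

Definition subspace_closed V :=
  forall a u v, V u -> V v -> V (fun x => a * u x + v x).

(** Additivity in the first argument is required on [V] only, because the forms
    in view are not linear off their domain. *)
Definition semi_inner V B := [/\ subspace_closed V,
  forall a u u' v, V u -> V u' -> V v -> B (fun x => a * u x + u' x) v = a * B u v + B u' v,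
  forall u v, V u -> V v -> B u v = B v u &
  forall v, V v -> 0 <= B v v].

Variables (V : set (X -> R)) (B : (X -> R) -> (X -> R) -> R).
Hypothesis VB : semi_inner V B.

Lemma semi_inner_sqr a u v : V u -> V v ->
  B (fun x => a * u x + v x) (fun x => a * u x + v x) = a ^+ 2 * B u u + 2 * a * B u v + B v v.
Proof.
move=> Vu Vv; have [cV lB sB _] := VB; have Vw := cV a _ _ Vu Vv.
rewrite lB// (sB u)// (sB v)// !lB// (sB v u)//; ring.
Qed.

(** The quadratic polynomial a |-> B (a u + v, a u + v) is nonnegative. *)
Lemma cauchy_schwarz_sqr u v : V u -> V v -> B u v ^+ 2 <= B u u * B v v.
Proof.
move=> Vu Vv; have [cV lB sB pB] := VB.
have Q a : 0 <= a ^+ 2 * B u u + 2 * a * B u v + B v v.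
  by rewrite -semi_inner_sqr//; apply: pB; exact: cV.
have := pB _ Vu; rewrite le_eqVlt => /predU1P[u0|u0].
  rewrite -u0 mul0r; have [->|uv0] := eqVneq (B u v) 0; first by rewrite expr0n.
  (* a null vector [u] with [B u v != 0] would make the polynomial take the value -1 *)
  have := Q (- (B v v + 1) / (2 * B u v)); rewrite -u0 mulr0 add0r.
  rewrite (_ : _ + _ = -1); first by rewrite ler0N1.
  by field; rewrite uv0.
have := Q (- B u v / B u u).
rewrite (_ : _ + _ = B v v - B u v ^+ 2 / B u u); last by field; rewrite gt_eqF.
by rewrite subr_ge0 ler_pdivrMr// mulrC.
Qed.

Lemma cauchy_schwarz u v : V u -> V v ->
  `|B u v| <= Num.sqrt (B u u) * Num.sqrt (B v v).
Proof.
move=> Vu Vv; have [_ _ _ pB] := VB.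
rewrite -sqrtrM ?pB// -sqrtr_sqr ler_sqrt ?mulr_ge0 ?pB//.
exact: cauchy_schwarz_sqr.
Qed.

Lemma semi_inner_triangle u v w : V (u \- v) -> V (v \- w) ->
  Num.sqrt (B (u \- w) (u \- w)) <=
  Num.sqrt (B (u \- v) (u \- v)) + Num.sqrt (B (v \- w) (v \- w)).
Proof.
move=> Vu Vv; have [_ _ _ pB] := VB.
rewrite (_ : u \- w = fun x => 1 * (u \- v) x + (v \- w) x); last first.
  by apply/funext => x /=; ring.
rewrite semi_inner_sqr//; set U := u \- v in Vu *; set W := v \- w in Vv *.
have := cauchy_schwarz Vu Vv; rewrite ler_norml => /andP[_ UW].
rewrite -[leRHS]ger0_norm ?addr_ge0 ?sqrtr_ge0// -sqrtr_sqr ler_sqrt ?sqr_ge0//.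
by rewrite sqrrD !sqr_sqrtr ?pB//; nra.
Qed.

End semi_inner_product.

Lemma sum_mul_le_sqrt (R : realType) (I : finType) (x y : I -> R) :
  `|\sum_i x i * y i| <= Num.sqrt (\sum_i x i ^+ 2) * Num.sqrt (\sum_i y i ^+ 2).
Proof.
have VB : semi_inner (X := I) setT (fun x y : I -> R => \sum_i x i * y i).
  split=> // [a u u' v _ _ _|u v _ _|v _].
  - by rewrite mulr_sumr -big_split; apply: eq_bigr => i _ /=; ring.
  - by apply: eq_bigr => i _; rewrite mulrC.
  - by apply: sumr_ge0 => i _; rewrite -expr2 sqr_ge0.
by have /(_ x y Logic.I Logic.I) := cauchy_schwarz VB.
Qed.

(** * Bilinear forms in a function and its gradient *)

Section jet_forms.
Context {R : realType} {d : nat}.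
Local Notation X := 'rV[R]_d.
Local Notation lam := (@lebesgue_rV R d).
Implicit Types (E : set X) (u v w : X -> R).

Definition bounded_coef E w := measurable_fun E w /\
  exists K : R, {ae lam, forall x, E x -> `|w x| <= K}.

Lemma bounded_coef_L2 E w u : measurable E -> bounded_coef E w -> L2 E u ->
  L2 E (fun x => w x * u x).
Proof. by move=> mE [mw [K wK]] u2; exact: L2_bounded_mul wK. Qed.

Lemma bounded_coef_integrable E w u v : measurable E -> bounded_coef E w ->
  L2 E u -> L2 E v -> integrable_on E (fun x => w x * u x * v x).
Proof. by move=> mE bw u2 v2; apply: L2_mul_integrable => //; exact: bounded_coef_L2. Qed.

Lemma bounded_coef_lin E a w1 w2 : measurable E -> bounded_coef E w1 -> bounded_coef E w2 ->
  bounded_coef E (fun x => a * w1 x + w2 x).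
Proof.
move=> mE [m1 [K1 wK1]] [m2 [K2 wK2]]; split.
  by apply: measurable_funD => //; exact: measurable_funM.
exists (`|a| * K1 + K2); apply: filterS2 wK1 wK2 => x w1K w2K Ex.
by rewrite (le_trans (ler_normD _ _))// lerD ?w2K// normrM ler_wpM2l ?w1K.
Qed.

Lemma bounded_coef_cst E a : bounded_coef E (fun=> a).
Proof. by split; [exact: measurable_cst|exists `|a|; apply: aeW]. Qed.

Lemma Linf_bounded_coef E F w : measurable E -> measurable F -> E `<=` F ->
  Linf F w -> bounded_coef E w.
Proof.
move=> mE mF EF /(Linf_bound mF)[K _ [mw wK]]; split; first exact: measurable_funS mw.
by exists K; apply: filterS wK => x wK Ex; apply: wK; exact: EF.
Qed.

Lemma semi_inner_L2 E : measurable E ->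
  semi_inner (L2 E) (fun u v => \int[lam]_(x in E) (u x * v x)).
Proof.
move=> mE; split=> [a u v|a u u' v u2 u'2 v2|u v _ _|v v2].
- exact: L2_lin.
- rewrite -RintegralZl//; last exact: L2_mul_integrable.
  rewrite -RintegralD//; last 2 first.
    by apply: integrable_onZ => //; exact: L2_mul_integrable.
    exact: L2_mul_integrable.
  by apply: eq_Rintegral => x _; ring.
- by apply: eq_Rintegral => x _; rewrite mulrC.
- by apply: Rintegral_ge0 => x _; rewrite -expr2 sqr_ge0.
Qed.

(** The minimum of the two functions equals [u] almost everywhere and is below
    [v] everywhere. *)
Lemma ae_le_Rintegral E u v : measurable E -> integrable_on E u -> integrable_on E v ->
  {ae lam, forall x, E x -> u x <= v x} ->
  \int[lam]_(x in E) u x <= \int[lam]_(x in E) v x.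
Proof.
move=> mE iu iv uv; pose w x := Num.min (u x) (v x).
have mu : measurable_fun E u by case/integrableP : iu => /measurable_EFinP.
have mv : measurable_fun E v by case/integrableP : iv => /measurable_EFinP.
have mw : measurable_fun E w by exact: measurable_minr.
have uw : aeeq E u w by apply: filterS uv => x uv Ex; rewrite /w min_l// uv.
rewrite (Rintegral_aeeq mE mu mw uw); apply: le_Rintegral => //.
  exact: integrable_on_aeeq iu.
by move=> x _; rewrite ge_min lexx orbT.
Qed.

(** A bounded weight costs a constant factor in the Cauchy-Schwarz inequality. *)
Lemma bounded_coef_CS E w : measurable E -> bounded_coef E w ->
  exists2 K : R, 0 <= K & forall u v, L2 E u -> L2 E v ->
    `|\int[lam]_(x in E) (w x * u x * v x)| <=
    K * Num.sqrt (\int[lam]_(x in E) (u x * u x)) * Num.sqrt (\int[lam]_(x in E) (v x * v x)).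
Proof.
move=> mE bw; have [mw [K wK]] := bw; exists `|K| => // u v u2 v2.
have wu2 := bounded_coef_L2 mE bw u2.
have /= := cauchy_schwarz (semi_inner_L2 mE) wu2 v2 => /le_trans; apply.
rewrite ler_wpM2r ?sqrtr_ge0// -[`|K|]normr_id -sqrtr_sqr -sqrtrM ?sqr_ge0//.
have iu := L2_mul_integrable mE u2 u2.
rewrite ler_wsqrtr// -RintegralZl//; apply: ae_le_Rintegral => //.
- exact: L2_mul_integrable.
- exact: integrable_onZ.
apply: filterS wK => x wK Ex; rewrite mulrACA -!expr2 ler_wpM2r ?sqr_ge0//.
rewrite -[leLHS]real_normK ?num_real// lerXn2r ?nnegrE//.
by rewrite (le_trans (wK Ex))// ler_norm.
Qed.

Definition jet_form E (W : option 'I_d -> option 'I_d -> X -> R) u v : R :=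
  \sum_a \sum_b \int[lam]_(x in E) (W a b x * jet E u a x * jet E v b x).

Variables (E : set X) (oE : open E) (Eoo : (lam E < +oo)%E).
Let mE : measurable E := open_measurable_rV oE.

(** The weak derivatives are linear only almost everywhere, which the integral
    does not see. *)
Lemma jet_form_linl W a u u' v : (forall a b, bounded_coef E (W a b)) ->
  H1 E u -> H1 E u' -> H1 E v ->
  jet_form E W (fun x => a * u x + u' x) v = a * jet_form E W u v + jet_form E W u' v.
Proof.
move=> bW Hu Hu' Hv; rewrite /jet_form mulr_sumr -big_split; apply: eq_bigr => k _ /=.
rewrite mulr_sumr -big_split; apply: eq_bigr => l _ /=.
have uk := jet_L2 k Hu; have u'k := jet_L2 k Hu'; have vl := jet_L2 l Hv.
have i1 := bounded_coef_integrable mE (bW k l) uk vl.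
have i2 := bounded_coef_integrable mE (bW k l) u'k vl.
rewrite -RintegralZl// -RintegralD//; last exact: integrable_onZ.
apply: Rintegral_aeeq => //.
- have i3 := bounded_coef_integrable mE (bW k l) (jet_L2 k (H1_lin a mE Eoo Hu Hu')) vl.
  by case/integrableP : i3 => /measurable_EFinP.
- have /integrableP[/measurable_EFinP +] := integrable_onD mE (integrable_onZ a mE i1) i2.
  by [].
by apply: filterS (jet_lin a k oE Eoo Hu Hu') => x /[apply] ->; ring.
Qed.

End jet_forms.

Lemma sum_option (V : nmodType) (I : finType) (F : option I -> V) :
  \sum_a F a = F None + \sum_i F (Some i).
Proof.
rewrite (bigD1 None)//=; congr (_ + _).
rewrite (reindex_omap Some id) /=; last by case.
by apply: eq_bigl => i; rewrite eqxx.
Qed.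

(** * The H^1 inner product and the forms of the problem *)

Section H1_inner_product.
Context {R : realType} {d : nat}.
Local Notation X := 'rV[R]_d.
Local Notation lam := (@lebesgue_rV R d).
Implicit Types (u v w : X -> R).
Variables (E : set X) (oE : open E) (Eoo : (lam E < +oo)%E).
Let mE : measurable E := open_measurable_rV oE.

Definition H1ip u v : R := jet_form E (fun a b => fun=> (a == b)%:R) u v.

Lemma H1ipE u v : H1ip u v = \sum_a \int[lam]_(x in E) (jet E u a x * jet E v a x).
Proof.
apply: eq_bigr => a _; rewrite (bigD1 a)//= big1 ?addr0.
  by apply: eq_Rintegral => x _; rewrite eqxx mul1r.
move=> b ba; rewrite eq_sym (negbTE ba).
by rewrite (Rintegral0 mE)// => x; rewrite !mul0r.
Qed.

Lemma semi_inner_H1 : semi_inner (H1 E) H1ip.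
Proof.
split=> [a u v|a u u' v Hu Hu' Hv|u v _ _|v Hv].
- exact: H1_lin.
- by apply: jet_form_linl => // k l; exact: bounded_coef_cst.
- by rewrite !H1ipE; apply: eq_bigr => a _; apply: eq_Rintegral => x _; rewrite mulrC.
- rewrite H1ipE; apply: sumr_ge0 => a _.
  by apply: Rintegral_ge0 => x _; rewrite -expr2 sqr_ge0.
Qed.

Lemma H1sqsemiE v : H1 E v ->
  H1sqsemi E v = \sum_i \int[lam]_(x in E) (jet E v (Some i) x * jet E v (Some i) x).
Proof.
move=> Hv; rewrite /H1sqsemi /dotv.
have iF i : integrable_on E (fun x => jet E v (Some i) x * jet E v (Some i) x).
  by apply: L2_mul_integrable => //; exact: jet_L2.
by rewrite (Rintegral_sum mE).
Qed.

Lemma H1ip_sqnorm v : H1 E v -> H1ip v v = L2sqnorm E v + H1sqsemi E v.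
Proof.
by move=> Hv; rewrite H1ipE sum_option H1sqsemiE.
Qed.

Lemma H1normE v : H1 E v -> H1norm E v = Num.sqrt (H1ip v v).
Proof. by move=> Hv; rewrite H1ip_sqnorm. Qed.

Lemma jet_le_H1norm v a : H1 E v ->
  Num.sqrt (\int[lam]_(x in E) (jet E v a x * jet E v a x)) <= H1norm E v.
Proof.
move=> Hv; rewrite H1normE// ler_wsqrtr// H1ipE (bigD1 a)//= lerDl.
by apply: sumr_ge0 => b _; apply: Rintegral_ge0 => x _; rewrite -expr2 sqr_ge0.
Qed.

Lemma jet_form_continuous W : (forall a b, bounded_coef E (W a b)) ->
  exists2 K : R, 0 <= K & forall u v, H1 E u -> H1 E v ->
    `|jet_form E W u v| <= K * H1norm E u * H1norm E v.
Proof.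
move=> bW; have bK a b := cid2 (bounded_coef_CS mE (bW a b)).
exists (\sum_a \sum_b s2val (bK a b)).
  by apply: sumr_ge0 => a _; apply: sumr_ge0 => b _; case: (bK a b).
move=> u v Hu Hv; rewrite !mulr_suml (le_trans (ler_norm_sum _ _ _))//.
apply: ler_sum => a _; rewrite !mulr_suml (le_trans (ler_norm_sum _ _ _))//.
apply: ler_sum => b _; case: (bK a b) => K /= K0 HK.
rewrite (le_trans (HK _ _ (jet_L2 a Hu) (jet_L2 b Hv)))//.
by rewrite ler_pM ?mulr_ge0 ?sqrtr_ge0 ?jet_le_H1norm// ler_wpM2l ?jet_le_H1norm.
Qed.

Variable c : coefficients R d.

Definition aE_weight (a b : option 'I_d) : X -> R :=
  match a, b with
  | Some j, Some i => fun x => kappa c x i j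
  | None, None => mu c
  | _, _ => fun=> 0
  end.

(** The mixed entries carry the skew part: half of the convection coefficient,
    with opposite signs. *)
Definition AE_weight (a b : option 'I_d) : X -> R :=
  match a, b with
  | Some i, None => fun x => 2^-1 * beta c x 0 i
  | None, Some i => fun x => - 2^-1 * beta c x 0 i
  | _, _ => aE_weight a b
  end.

Hypotheses (bkappa : forall i j, bounded_coef E (fun x => kappa c x i j))
  (bbeta : forall i, bounded_coef E (fun x => beta c x 0 i))
  (bmu : bounded_coef E (mu c)).

Lemma aE_weight_bounded a b : bounded_coef E (aE_weight a b).
Proof. by case: a => [j|]; case: b => [i|] //=; exact: bounded_coef_cst. Qed.

Lemma AE_weight_bounded a b : bounded_coef E (AE_weight a b).
Proof.
have bZ r i : bounded_coef E (fun x => r * beta c x 0 i).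
  have := bounded_coef_lin r mE (bbeta i) (bounded_coef_cst E 0).
  by under eq_fun do rewrite addr0.
by case: a => [j|]; case: b => [i|] /=.
Qed.

Lemma jet_form_split W u v : jet_form E W u v =
  \int[lam]_(x in E) (W None None x * u x * v x) +
  \sum_i \int[lam]_(x in E) (W None (Some i) x * u x * wgrad E v x 0 i) +
  \sum_i \int[lam]_(x in E) (W (Some i) None x * wgrad E u x 0 i * v x) +
  \sum_i \sum_j \int[lam]_(x in E)
    (W (Some i) (Some j) x * wgrad E u x 0 i * wgrad E v x 0 j).
Proof.
rewrite /jet_form sum_option sum_option /= -!addrA; congr (_ + (_ + _)).
by rewrite -big_split; apply: eq_bigr => i _; rewrite sum_option.
Qed.

Lemma aE_jet_form u v : H1 E u -> H1 E v -> aE c E u v = jet_form E aE_weight u v.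
Proof.
move=> Hu Hv; have iF i j := bounded_coef_integrable mE (bkappa i j)
  (jet_L2 (Some j) Hu) (jet_L2 (Some i) Hv).
rewrite jet_form_split /aE [LHS]addrC; congr (_ + _) => /=.
  have z0 (f : 'I_d -> X -> R) : (forall i x, f i x = 0) ->
      \sum_i \int[lam]_(x in E) f i x = 0.
    by move=> f0; rewrite big1// => i _; exact: (Rintegral0 mE).
  by rewrite !z0 ?addr0// => i x; rewrite !mul0r.
transitivity (\int[lam]_(x in E) \sum_j \sum_i
    (kappa c x i j * jet E u (Some j) x * jet E v (Some i) x)).
  apply: eq_Rintegral => x _; rewrite /dotv exchange_big; apply: eq_bigr => i _ /=.
  rewrite /kmul mxE mulr_suml; apply: eq_bigr => j _; rewrite mxE; ring.
rewrite (Rintegral_sum mE); last by move=> j; exact: integrable_on_sum.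
by apply: eq_bigr => j _; rewrite (Rintegral_sum mE).
Qed.

Lemma AE_jet_form u v : H1 E u -> H1 E v -> AE c E u v = jet_form E AE_weight u v.
Proof.
move=> Hu Hv; rewrite /AE aE_jet_form// !jet_form_split /bE.
have iF1 i := bounded_coef_integrable mE (bbeta i) (jet_L2 (Some i) Hu) Hv.1.
have iF2 i := bounded_coef_integrable mE (bbeta i) Hu.1 (jet_L2 (Some i) Hv).
have -> : \int[lam]_(x in E) (dotv (beta c x) (wgrad E u x) * v x -
    u x * dotv (beta c x) (wgrad E v x)) =
  \sum_i \int[lam]_(x in E) (beta c x 0 i * jet E u (Some i) x * v x) -
  \sum_i \int[lam]_(x in E) (beta c x 0 i * u x * jet E v (Some i) x).
  rewrite -!(Rintegral_sum mE)// -RintegralB//; [|exact: integrable_on_sum..].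
  apply: eq_Rintegral => x _; rewrite /dotv mulr_suml mulr_sumr; congr (_ - _).
  by apply: eq_bigr => i _; rewrite /=; ring.
have -> : \sum_i \int[lam]_(x in E) (AE_weight None (Some i) x * u x * wgrad E v x 0 i) =
   - (2^-1 * \sum_i \int[lam]_(x in E) (beta c x 0 i * u x * jet E v (Some i) x)).
  rewrite mulr_sumr -sumrN; apply: eq_bigr => i _; rewrite -mulNr -RintegralZl//; last exact: iF2.
  by apply: eq_Rintegral => x _ /=; ring.
have -> : \sum_i \int[lam]_(x in E) (AE_weight (Some i) None x * wgrad E u x 0 i * v x) =
   2^-1 * \sum_i \int[lam]_(x in E) (beta c x 0 i * jet E u (Some i) x * v x).
  rewrite mulr_sumr; apply: eq_bigr => i _; rewrite -RintegralZl//; last exact: iF1.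
  by apply: eq_Rintegral => x _ /=; ring.
have z0 (f : 'I_d -> X -> R) : (forall i x, f i x = 0) ->
    \sum_i \int[lam]_(x in E) f i x = 0.
  by move=> f0; rewrite big1// => i _; exact: (Rintegral0 mE).
rewrite [X in _ + X + _ + _ + _]z0 ?[X in _ + X + _ + _]z0; try by move=> i x /=; rewrite !mul0r.
rewrite /=; ring.
Qed.

End H1_inner_product.

(** * Null functions and pointwise ellipticity *)

Section negligible_functions.
Context {R : realType} {d : nat}.
Local Notation X := 'rV[R]_d.
Local Notation lam := (@lebesgue_rV R d).
Implicit Types (u v w : X -> R).
Variables (E : set X) (oE : open E) (Eoo : (lam E < +oo)%E).
Let mE : measurable E := open_measurable_rV oE.

Lemma H1_0 : H1 E (fun=> 0).
Proof.
have z2 : L2 E (fun=> 0) by exact: L2_cst.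
split => //; exists (fun=> 0); split=> [i|phi _ i].
  by rewrite (_ : (fun _ => _) = fun=> 0)//; apply/funext => x; rewrite mxE.
by rewrite !(Rintegral0 mE) ?oppr0// => x; rewrite ?mxE mul0r.
Qed.

(** The weak gradient of such a function is the one of the zero function, where
    the inner product vanishes by linearity. *)
Lemma aeeq0_H1norm w : H1 E w -> aeeq E w (fun=> 0) -> H1norm E w = 0.
Proof.
move=> Hw w0; have z2 : L2 E (fun=> 0) by exact: L2_cst.
have mw := L2_measurable mE Hw.1; have mz := L2_measurable mE z2.
have [_ lB _ _] := semi_inner_H1 oE Eoo.
have z0 : H1ip E (fun=> 0) (fun=> 0) = 0.
  have /esym/eqP := lB (-1) _ _ _ H1_0 H1_0 H1_0.
  rewrite (_ : (fun x => _) = fun=> 0); last by apply/funext => x; rewrite mulr0 addr0.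
  by rewrite mulN1r addNr eq_sym => /eqP.
rewrite -[RHS]sqrtr0 -z0 (H1ip_sqnorm oE H1_0) /H1norm /H1sqsemi.
rewrite (wgrad_aeeq mE mw mz Eoo w0); congr (Num.sqrt (_ + _)).
apply: Rintegral_aeeq => //; [exact: measurable_funX..|].
by apply: filterS w0 => x /[apply] ->.
Qed.

(** The zero test function approximates such a function exactly. *)
Lemma H10_aeeq0 w : measurable_fun E w -> aeeq E w (fun=> 0) -> H10 E w.
Proof.
move=> mw w0.
have w2 : L2 E w.
  apply: (L2_bounded (K := 0)) => //.
  by apply: filterS w0 => x /[apply] ->; rewrite normr0.
have Hw : H1 E w by apply: H1_aeeq H1_0 => //; exact: aeeq_sym.
have supp0 : [set x : X | (0 : R) != 0] = set0.
  by apply/seteqP; split=> x //=; rewrite eqxx.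
split => // e e0; exists (fun=> 0).
  split=> [m||]; first by apply: flat_algebra_Ck; exact: flat_cst.
    by rewrite supp0 closure0; exact: compact0.
  by rewrite supp0 closure0.
rewrite (_ : w \- _ = w); last by apply/funext => x /=; rewrite subr0.
by rewrite aeeq0_H1norm.
Qed.

End negligible_functions.

Section ellipticity.
Context {R : realType} {d : nat}.
Local Notation X := 'rV[R]_d.
Local Notation lam := (@lebesgue_rV R d).

(** In dimension at least 1 a point is null, so the field equal to [xi] at the
    point [x] and to 0 elsewhere has components in H^1_0: a condition on the
    values of all H^1_0 fields is a condition on all vectors. *)
Lemma pointwise_ellipticity (Omega : set X) (Q : X -> X -> Prop) :
  (0 < d)%N -> open Omega -> (lam Omega < +oo)%E ->
  {ae lam, forall x, Omega x -> forall v : X -> X,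
    (forall i, H10 Omega (fun y => v y 0 i)) -> Q x (v x)} ->
  {ae lam, forall x, Omega x -> forall xi, Q x xi}.
Proof.
move=> d0 oO Ooo; apply: filterS => x Qx Ox xi.
have [m1 x0] := lebesgue_rV_set1 x d0.
have := Qx Ox (fun y => if y == x then xi else 0); rewrite eqxx; apply=> i.
apply: H10_aeeq0 => //.
  rewrite (_ : (fun _ => _) = (cst (xi 0 i)) \_ [set x]).
    apply: measurable_funTS; apply/(measurable_restrictT _ m1); exact: measurable_cst.
  apply/funext => y; rewrite /patch; case: eqP => [->|yx].
    by rewrite mem_set.
  by rewrite mxE memNset.
exists [set x]; split => // y /= /not_implyP[_].
by have [->//|yx] := eqVneq y x; rewrite mxE.
Qed.

End ellipticity.

(** * Elements and broken spaces *)

Section polytopes.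
Context {R : realType} {d : nat}.
Local Notation X := 'rV[R]_d.

Lemma polytopal_domain_open (E : set X) : polytopal_domain E -> open E.
Proof. by case. Qed.

Lemma polytopal_domain_lty (E : set X) : polytopal_domain E -> (lebesgue_rV d E < +oo)%E.
Proof. by move=> [_ oE bE _ _]; apply: lebesgue_rV_bounded => //; exact: open_measurable_rV. Qed.

(** Otherwise the domain, a nonempty open set, would be negligible. *)
Lemma polytopal_domain_cst (E : set X) (a b : R) : polytopal_domain E -> a != b ->
  ~ aeeq E (fun=> a) (fun=> b).
Proof.
move=> [E0 oE _ _ _] /eqP ab [N [mN N0 EN]].
have := lebesgue_rV_open_gt0 oE E0; rewrite lt_neqAle => /andP[/eqP + _]; apply.
apply/esym/eqP; rewrite -measure_le0 -N0; apply: le_measure; rewrite ?inE//.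
  exact: open_measurable_rV.
by move=> x Ex; apply: EN => /=; apply/not_implyP.
Qed.

(** Only the zero exponent carries a coefficient. *)
Lemma polyn_cst k (a : R) : @Defs.polyn R d k (fun=> a).
Proof.
exists (fun e => if e == [ffun=> ord0] then a else 0) => x.
rewrite (bigD1 [ffun=> ord0])/=; last by rewrite big1// => i _; rewrite ffunE.
rewrite eqxx big1 ?mulr1; last by move=> i _; rewrite ffunE expr0.
by rewrite big1 ?addr0// => e /andP[_ /negbTE ->]; rewrite mul0r.
Qed.

End polytopes.

Section broken_spaces.
Context {R : realType} {d : nat}.
Local Notation X := 'rV[R]_d.
Local Notation lam := (@lebesgue_rV R d).
Variables (D : discretization R d) (Omega : set X).
Hypotheses (oC : forall i, open (cell D i)) (Coo : forall i, (lam (cell D i) < +oo)%E)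
  (oO : open Omega) (CO : forall i, cell D i `<=` Omega).
Arguments oC : clear implicits.
Arguments CO : clear implicits.
Implicit Types (u v w : X -> R) (i : elt D).
Let mC i : measurable (cell D i) := open_measurable_rV (oC i).
Let mO : measurable Omega := open_measurable_rV oO.

Definition broken_H1 : set (X -> R) := [set v | forall i, H1 (cell D i) v].

Definition H1hip u v : R := \sum_i H1ip (cell D i) u v.

Lemma semi_inner_H1h : semi_inner broken_H1 H1hip.
Proof.
have SI i := semi_inner_H1 (oC i) (Coo i).
split=> [a u v Hu Hv i|a u u' v Hu Hu' Hv|u v Hu Hv|v Hv].
- exact: H1_lin.
- rewrite /H1hip mulr_sumr -big_split; apply: eq_bigr => i _.
  by have [_ lB _ _] := SI i; exact: lB.
- by apply: eq_bigr => i _; have [_ _ sB _] := SI i; exact: sB.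
- by apply: sumr_ge0 => i _; have [_ _ _ pB] := SI i; exact: pB.
Qed.

Lemma H1norm_ge0 (E : set X) v : 0 <= H1norm E v.
Proof. exact: sqrtr_ge0. Qed.

Lemma H1hnorm_ge0 v : 0 <= H1hnorm D v.
Proof. exact: sqrtr_ge0. Qed.

Lemma H1norm_sqr i v : H1 (cell D i) v -> H1norm (cell D i) v ^+ 2 = H1ip (cell D i) v v.
Proof.
move=> Hv; have [_ _ _ pB] := semi_inner_H1 (oC i) (Coo i).
by rewrite (H1normE (oC i) Hv) sqr_sqrtr// pB.
Qed.

Lemma H1hnormE v : broken_H1 v -> H1hnorm D v = Num.sqrt (H1hip v v).
Proof.
by move=> Hv; congr Num.sqrt; apply: eq_bigr => i _; rewrite H1norm_sqr.
Qed.

Lemma broken_H1_sub u v : broken_H1 u -> broken_H1 v -> broken_H1 (u \- v).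
Proof.
move=> Hu Hv; have [cl _ _ _] := semi_inner_H1h.
rewrite (_ : u \- v = fun x => -1 * v x + u x); first exact: cl.
by apply/funext => x /=; ring.
Qed.

Lemma H1hnorm_triangle u v w : broken_H1 u -> broken_H1 v -> broken_H1 w ->
  H1hnorm D (u \- w) <= H1hnorm D (u \- v) + H1hnorm D (v \- w).
Proof.
move=> Hu Hv Hw; rewrite !H1hnormE; try exact: broken_H1_sub.
by apply: (semi_inner_triangle semi_inner_H1h); exact: broken_H1_sub.
Qed.

Lemma H1hnorm_subC u v : broken_H1 u -> broken_H1 v ->
  H1hnorm D (u \- v) = H1hnorm D (v \- u).
Proof.
move=> Hu Hv; rewrite !H1hnormE; try exact: broken_H1_sub.
congr Num.sqrt; have [_ _ sB _] := semi_inner_H1h.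
have subE (f g : X -> R) : f \- g = fun x => -1 * g x + f x.
  by apply/funext => x /=; ring.
by rewrite !subE !(semi_inner_sqr semi_inner_H1h)// (sB v u)//; ring.
Qed.

Lemma H1norm_le_H1hnorm i v : H1norm (cell D i) v <= H1hnorm D v.
Proof.
rewrite -[leLHS]ger0_norm ?H1norm_ge0// -sqrtr_sqr ler_wsqrtr// (bigD1 i)//= lerDl.
by apply: sumr_ge0 => j _; rewrite sqr_ge0.
Qed.

Lemma aeeq0_H1hnorm v : broken_H1 v -> aeeq Omega v (fun=> 0) -> H1hnorm D v = 0.
Proof.
move=> Hv v0; rewrite /H1hnorm big1 ?sqrtr0// => i _.
by rewrite aeeq0_H1norm ?expr0n//; exact: aeeq_S v0.
Qed.

Lemma sum_H1norm_le u v :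
  \sum_i H1norm (cell D i) u * H1norm (cell D i) v <= H1hnorm D u * H1hnorm D v.
Proof.
by apply: le_trans (ler_norm _) (sum_mul_le_sqrt _ _).
Qed.

Lemma H1h_lin a u v : H1h D Omega u -> H1h D Omega v -> H1h D Omega (fun x => a * u x + v x).
Proof. by move=> [u2 Hu] [v2 Hv]; split=> [|i]; [exact: L2_lin|exact: H1_lin]. Qed.

(** The indicators of disjoint elements of [Omega] add up to at most the
    indicator of [Omega]. *)
Lemma sum_L2sqnorm_le v : L2 Omega v -> (forall i j, i != j -> cell D i `&` cell D j = set0) ->
  \sum_i L2sqnorm (cell D i) v <= L2sqnorm Omega v.
Proof.
move=> v2 disj.
have ir (E : set X) : measurable E -> E `<=` Omega ->
    integrable_on setT ((fun x => v x ^+ 2) \_ E).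
  move=> mE EO; rewrite /integrable_on -restrict_EFin; apply/(integrable_mkcond _ mE).
  exact: ((L2P _ mE).1 (L2_S mE mO EO v2)).2.
rewrite /L2sqnorm; under eq_bigr do rewrite Rintegral_mkcond.
rewrite -(Rintegral_sum measurableT); last by move=> i; exact: ir.
rewrite [leRHS]Rintegral_mkcond; apply: le_Rintegral => //.
- by apply: integrable_on_sum => // i; exact: ir.
- exact: ir.
move=> x _; have [[i Cx]|nC] := pselect (exists i, cell D i x).
  rewrite (bigD1 i)//= big1 ?addr0.
    by rewrite /patch mem_set// mem_set//; exact: CO Cx.
  move=> j ji; rewrite /patch memNset// => Cjx.
  by have := disj _ _ ji; apply/eqP/set0P; exists x.
rewrite big1; first by rewrite /patch; case: ifP => // _; exact: sqr_ge0.
by move=> i _; rewrite /patch memNset// => Cx; apply: nC; exists i.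
Qed.

Hypothesis Vfin : findim_subspace D Omega (Vh D).

Lemma Vh_H1h v : Vh D v -> H1h D Omega v.
Proof. by case: Vfin => N [phi [_ Vphi]] /Vphi[]. Qed.

Lemma Vh_broken_H1 v : Vh D v -> broken_H1 v.
Proof. by move=> /Vh_H1h[]. Qed.

Lemma Vh_subspace : subspace_closed (Vh D).
Proof.
move=> a u v Vu Vv; have [N [phi [_ Vphi]]] := Vfin; apply/Vphi.
have [Hu [b ub]] := (Vphi _).1 Vu; have [Hv [e ve]] := (Vphi _).1 Vv.
split; first exact: H1h_lin.
exists (fun n => a * b n + e n); apply: filterS2 ub ve => x ub ve Ox.
rewrite ub// ve// mulr_sumr -big_split; apply: eq_bigr => n _ /=; ring.
Qed.

Lemma Vh_sub u v : Vh D u -> Vh D v -> Vh D (u \- v).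
Proof.
move=> Vu Vv; rewrite (_ : u \- v = fun x => -1 * v x + u x); first exact: Vh_subspace.
by apply/funext => x /=; ring.
Qed.

Lemma Vh_VhE i v : Vh D v -> VhE i v.
Proof. by move=> Vv; split; [have [_ /(_ i)[]] := Vh_H1h Vv|exists v => //; exact: aeW]. Qed.

Lemma VhE_H1 i w : VhE i w -> H1 (cell D i) w.
Proof.
move=> [w2 [v Vv wv]]; apply: (H1_aeeq (mC i) (Coo i) w2 (aeeq_sym wv)).
exact: Vh_broken_H1.
Qed.

Lemma VhE_subspace i : subspace_closed (VhE (D := D) i).
Proof.
move=> a u v [u2 [u' Vu' uu']] [v2 [v' Vv' vv']]; split; first exact: L2_lin.
exists (fun x => a * u' x + v' x); first exact: Vh_subspace.
by apply: filterS2 uu' vv' => x uu' vv' Cx; rewrite uu'// vv'.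
Qed.

Lemma VhE_aeeq i w w' : L2 (cell D i) w -> aeeq (cell D i) w w' -> VhE i w' -> VhE i w.
Proof. by move=> w2 ww' [_ [v Vv w'v]]; split => //; exists v => //; exact: aeeq_trans w'v. Qed.

End broken_spaces.

(** * The error bound for fixed discrete functions *)

Definition strang_constant (R : realType) (alpha M_A M_h : R) : R :=
  1 + (1 + M_A + M_h) / alpha.

(** The real arithmetic of the estimate. [N] is the norm of e = uh - vh, [a],
    [b] and [q] are those of u - p, u - vh and p - vh, and [L] is that of
    u - uh; [l], [n] and [S] are the load, nonconformity and total inconsistency
    errors. *)
Lemma strang_arithmetic (R : realType) (alpha M_A M_h N l n S a b q L r1 r2 t1 t2 t3 : R) :
  0 < alpha -> 0 < M_A -> 0 < M_h -> 0 <= N -> 0 <= l -> 0 <= n -> 0 <= S ->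
  0 <= a -> 0 <= b -> L <= b + N -> q <= a + b ->
  alpha * N ^+ 2 <= r1 - r2 + (t1 + t2 + t3) -> r1 <= l * N -> - r2 <= n * N ->
  t1 <= M_A * (a * N) -> t2 <= S * N -> t3 <= M_h * (q * N) ->
  L <= strang_constant alpha M_A M_h * (b + l + (a + S) + n).
Proof.
move=> a0 MA0 Mh0 N0 l0 n0 S0 np0 nv0 LN qab coer h1 h2 h3 h4 h5.
have key : alpha * N <= l + n + M_A * a + S + M_h * (a + b).
  have [->|Npos] := eqVneq N 0.
    by rewrite mulr0 !addr_ge0// mulr_ge0 ?addr_ge0// ltW.
  have {}Npos : 0 < N by rewrite lt_neqAle eq_sym Npos.
  rewrite -(ler_pM2r Npos) -mulrA -expr2; apply: le_trans coer _.
  have := ler_wpM2l (ltW Mh0) (ler_wpM2r N0 qab).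
  rewrite !mulrDl -!mulrA; lra.
have {}key : N <= (l + n + M_A * a + S + M_h * (a + b)) / alpha.
  by rewrite ler_pdivlMr// mulrC.
apply: le_trans LN _; rewrite /strang_constant mulrDl mul1r.
set T := b + l + (a + S) + n.
apply: lerD; first by rewrite /T; lra.
apply: le_trans key _; rewrite mulrAC ler_wpM2r ?invr_ge0 ?(ltW a0)//.
have aT : a <= T by rewrite /T; lra.
have abT : a + b <= T by rewrite /T; lra.
have lT : l + n + S <= T by rewrite /T; lra.
have := ler_wpM2l (ltW MA0) aT; have := ler_wpM2l (ltW Mh0) abT.
by rewrite !mulrDl mul1r; lra.
Qed.

Section strang.
Context {R : realType} {d : nat}.
Local Notation X := 'rV[R]_d.
Local Notation lam := (@lebesgue_rV R d).
Variables (c : coefficients R d) (D : discretization R d) (Omega : set X) (f : X -> R).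
Hypotheses (oC : forall i, open (cell D i)) (Coo : forall i, (lam (cell D i) < +oo)%E)
  (oO : open Omega)
  (Vfin : findim_subspace D Omega (Vh D)).
Hypotheses (bkappa : forall i k l, bounded_coef (cell D i) (fun x => kappa c x k l))
  (bbeta : forall i k, bounded_coef (cell D i) (fun x => beta c x 0 k))
  (bmu : forall i, bounded_coef (cell D i) (mu c)).
Hypothesis bilA : forall i, bilinear_on (cell D i) (VhE (D := D) i) (AhE (D := D) i).
Arguments oC : clear implicits.
Implicit Types (u v w p : X -> R) (i : elt D).

Lemma subfE u v : u \- v = fun x => -1 * v x + u x.
Proof. by apply/funext => x /=; ring. Qed.

Lemma AE_subl i u v w : H1 (cell D i) u -> H1 (cell D i) v -> H1 (cell D i) w ->
  AE c (cell D i) (u \- v) w = AE c (cell D i) u w - AE c (cell D i) v w.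
Proof.
move=> Hu Hv Hw; have mC := open_measurable_rV (oC i).
have Huv : H1 (cell D i) (u \- v) by rewrite subfE; exact: H1_lin.
rewrite !(AE_jet_form (oC i) (bkappa i) (bbeta i))// subfE.
have bW a b := AE_weight_bounded (oC i) (bkappa i) (bbeta i) (bmu i) a b.
by rewrite (jet_form_linl (oC i) (Coo i) (-1) bW Hv Hu Hw) mulN1r addrC.
Qed.

Lemma AhE_subl i u v w : VhE i u -> VhE i v -> VhE i w ->
  AhE i (u \- v) w = AhE i u w - AhE i v w.
Proof.
by move=> Vu Vv Vw; have [lA _ _] := bilA i; rewrite subfE lA// mulN1r addrC.
Qed.

Variables (alpha M M_A M_h : R).
Hypothesis cc : coercivity_continuity c D alpha M M_A M_h.

(** Real numbers [l], [n] and [s] stand for the suprema, so that no extended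
    real arithmetic enters the core of the argument. *)
Lemma strang_bound u uh vh p (l n : R) (s : elt D -> R) :
  broken_H1 D u -> Vh D uh -> (forall v, Vh D v -> Ah D uh v = fh D v) -> Vh D vh ->
  (forall i, VhE i p) -> (forall i, 0 <= s i) ->
  `|fh D (uh \- vh) - ip Omega f (uh \- vh)| <= l * H1hnorm D (uh \- vh) ->
  `|A c D u (uh \- vh) - ip Omega f (uh \- vh)| <= n * H1hnorm D (uh \- vh) ->
  (forall i, `|AE c (cell D i) p (uh \- vh) - AhE i p (uh \- vh)| <=
     s i * H1norm (cell D i) (uh \- vh)) ->
  0 <= l -> 0 <= n ->
  H1hnorm D (u \- uh) <= strang_constant alpha M_A M_h *
    (H1hnorm D (u \- vh) + l + (H1hnorm D (u \- p) + \sum_i s i) + n).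
Proof.
move=> Hu Vuh Auh Vvh Vp s0 hl hn hs l0 n0.
set e := uh \- vh in hl hn hs *; set N := H1hnorm D e in hl hn *.
have [[a0 M0 MA0 Mh0] coer _ contA contAh] := cc.
have Hvh := Vh_broken_H1 Vfin Vvh; have Huh := Vh_broken_H1 Vfin Vuh.
have Ve : Vh D e := Vh_sub oC Coo oO Vfin Vuh Vvh.
have He := Vh_broken_H1 Vfin Ve.
have Hp : broken_H1 D p by move=> i; exact: (VhE_H1 oC Coo Vfin (Vp i)).
have VE v i : Vh D v -> VhE i v by move=> Vv; exact: (Vh_VhE Vfin i Vv).
have N0 : 0 <= N by exact: H1hnorm_ge0.
have np0 : 0 <= H1hnorm D (u \- p) by exact: H1hnorm_ge0.
have nv0 : 0 <= H1hnorm D (u \- vh) by exact: H1hnorm_ge0.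
have S0 : 0 <= \sum_i s i by exact: sumr_ge0.
have tri : H1hnorm D (u \- uh) <= H1hnorm D (u \- vh) + N.
  rewrite /N /e (H1hnorm_subC oC Coo Huh Hvh).
  exact: (H1hnorm_triangle oC Coo Hu Hvh Huh).
have trip : H1hnorm D (p \- vh) <= H1hnorm D (u \- p) + H1hnorm D (u \- vh).
  rewrite (H1hnorm_subC oC Coo Hu Hp).
  exact: (H1hnorm_triangle oC Coo Hp Hu Hvh).
(* consistency splitting of the energy of [e] *)
have errE : Ah D e e = (fh D e - ip Omega f e) - (A c D u e - ip Omega f e) +
    (\sum_i AE c (cell D i) (u \- p) e +
     \sum_i (AE c (cell D i) p e - AhE i p e) + \sum_i AhE (D := D) i (p \- vh) e).
  have -> : Ah D e e = fh D e - Ah D vh e.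
    rewrite -Auh// /Ah -sumrB; apply: eq_bigr => i _.
    by rewrite {1}/e AhE_subl//; exact: VE.
  have -> : \sum_i AE c (cell D i) (u \- p) e +
      \sum_i (AE c (cell D i) p e - AhE i p e) + \sum_i AhE (D := D) i (p \- vh) e =
      A c D u e - Ah D vh e; last by ring.
  rewrite /A /Ah -!big_split -sumrB; apply: eq_bigr => i _ /=.
  by rewrite AE_subl// AhE_subl//; [ring|exact: VE..].
have b1 : `|\sum_i AE c (cell D i) (u \- p) e| <= M_A * (H1hnorm D (u \- p) * N).
  apply: le_trans (ler_norm_sum _ _ _) _.
  apply: le_trans (_ : M_A * (\sum_i H1norm (cell D i) (u \- p) * H1norm (cell D i) e) <= _).
    rewrite mulr_sumr; apply: ler_sum => i _; rewrite mulrA; apply: contA => //.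
    exact: (broken_H1_sub oC Coo Hu Hp).
  exact: (ler_wpM2l (ltW MA0) (sum_H1norm_le D _ _)).
have b2 : `|\sum_i (AE c (cell D i) p e - AhE i p e)| <= (\sum_i s i) * N.
  apply: le_trans (ler_norm_sum _ _ _) _; rewrite mulr_suml; apply: ler_sum => i _.
  exact: le_trans (hs i) (ler_wpM2l (s0 i) (H1norm_le_H1hnorm i e)).
have b3 : `|\sum_i AhE (D := D) i (p \- vh) e| <= M_h * (H1hnorm D (p \- vh) * N).
  apply: le_trans (ler_norm_sum _ _ _) _.
  apply: le_trans (_ : M_h * (\sum_i H1norm (cell D i) (p \- vh) * H1norm (cell D i) e) <= _).
    rewrite mulr_sumr; apply: ler_sum => i _; rewrite mulrA; apply: contAh.
      by rewrite subfE; apply: (VhE_subspace oC Coo oO Vfin) => //; exact: VE.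
    exact: VE.
  exact: (ler_wpM2l (ltW Mh0) (sum_H1norm_le D _ _)).
have coerE := coer _ Ve; rewrite errE in coerE.
move: hl hn b1 b2 b3; rewrite !ler_norml.
move=> /andP[_ hl] /andP[hn _] /andP[_ b1] /andP[_ b2] /andP[_ b3].
apply: (strang_arithmetic a0 MA0 Mh0 N0 l0 n0 S0 np0 nv0 tri trip coerE hl _ b1 b2 b3).
by rewrite lerNl.
Qed.

End strang.

(** * Existence of coercivity and continuity constants *)

Section constants.
Context {R : realType} {d : nat}.
Local Notation X := 'rV[R]_d.
Local Notation lam := (@lebesgue_rV R d).
Variables (c : coefficients R d) (D : discretization R d) (Omega : set X).
Variables (kappa_lo mu0 alpha_lo alpha_up C_b C_PF : R).
Hypotheses (oC : forall i, open (cell D i)) (Coo : forall i, (lam (cell D i) < +oo)%E)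
  (oO : open Omega) (CO : forall i, cell D i `<=` Omega)
  (Vfin : findim_subspace D Omega (Vh D)).
Hypotheses (bkappa : forall i k l, bounded_coef (cell D i) (fun x => kappa c x k l))
  (bbeta : forall i k, bounded_coef (cell D i) (fun x => beta c x 0 k))
  (bmu : forall i, bounded_coef (cell D i) (mu c)).
Arguments oC : clear implicits.
Arguments CO : clear implicits.
Implicit Types (u v w p : X -> R) (i : elt D).

(** Finitely many elements: the sum of the local constants bounds each of them. *)
Lemma uniform_bound (P : elt D -> R -> Prop) :
  (forall i K L, K <= L -> P i K -> P i L) -> (forall i, exists2 K, 0 <= K & P i K) ->
  exists2 K, 0 < K & forall i, P i K.
Proof.
move=> monoP exP; pose K i := s2val (cid2 (exP i)).
have K0 i : 0 <= K i by rewrite /K; case: cid2.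
exists (1 + \sum_i K i); first by rewrite ltr_pwDl// sumr_ge0.
move=> i; apply: (monoP i (K i)); last by rewrite /K; case: cid2.
rewrite (bigD1 i)//= addrCA lerDl addr_ge0// sumr_ge0// => j _; exact: K0.
Qed.

Lemma jet_form_uniform (W : option 'I_d -> option 'I_d -> X -> R) :
  (forall i a b, bounded_coef (cell D i) (W a b)) ->
  exists2 K, 0 < K & forall i u v, H1 (cell D i) u -> H1 (cell D i) v ->
    `|jet_form (cell D i) W u v| <= K * H1norm (cell D i) u * H1norm (cell D i) v.
Proof.
move=> bW; apply: uniform_bound => [i K L KL PK u v Hu Hv|i].
  by rewrite (le_trans (PK u v Hu Hv))// !ler_wpM2r ?H1norm_ge0.
exact: (jet_form_continuous (oC i) (bW i)).
Qed.

Lemma AE_continuous : exists2 K, 0 < K & forall i u v,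
  H1 (cell D i) u -> H1 (cell D i) v ->
  `|AE c (cell D i) u v| <= K * H1norm (cell D i) u * H1norm (cell D i) v.
Proof.
have [K K0 HK] := jet_form_uniform (fun i a b =>
  AE_weight_bounded (oC i) (bkappa i) (bbeta i) (bmu i) a b).
exists K => // i u v Hu Hv; rewrite (AE_jet_form (oC i) (bkappa i) (bbeta i))//.
exact: HK.
Qed.

Lemma aE_continuous : exists2 K, 0 < K & forall i u v,
  H1 (cell D i) u -> H1 (cell D i) v ->
  `|aE c (cell D i) u v| <= K * H1norm (cell D i) u * H1norm (cell D i) v.
Proof.
have [K K0 HK] := jet_form_uniform (fun i a b => aE_weight_bounded (bkappa i) (bmu i) a b).
exists K => // i u v Hu Hv; rewrite (aE_jet_form (oC i) (bkappa i))//.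
exact: HK.
Qed.

Hypothesis ell : {ae lam, forall x, Omega x -> forall xi : X,
   kappa_lo * dotv xi xi <= dotv xi (kmul c x xi)}.
Hypotheses (mu00 : 0 <= mu0) (mu_ge : {ae lam, forall x, Omega x -> mu0 <= mu c x}).

Lemma dotvC (x y : X) : dotv x y = dotv y x.
Proof. by apply: eq_bigr => i _; rewrite mulrC. Qed.

(** The zero order term is nonnegative since mu is, and the second order term is
    bounded below pointwise. *)
Lemma aE_coercive i v : H1 (cell D i) v ->
  kappa_lo * H1sqsemi (cell D i) v <= aE c (cell D i) v v.
Proof.
move=> Hv; have mC := open_measurable_rV (oC i).
have ig : integrable_on (cell D i) (fun x => dotv (wgrad (cell D i) v x) (wgrad (cell D i) v x)).
  by apply: integrable_on_sum => // j; apply: L2_mul_integrable => //; exact: (jet_L2 (Some j) Hv).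
have ik : integrable_on (cell D i)
    (fun x => dotv (kmul c x (wgrad (cell D i) v x)) (wgrad (cell D i) v x)).
  rewrite (_ : (fun _ => _) = fun x => \sum_l \sum_j
      (kappa c x l j * jet (cell D i) v (Some j) x * jet (cell D i) v (Some l) x)).
    apply: integrable_on_sum => // l; apply: integrable_on_sum => // j.
    by apply: bounded_coef_integrable => //; exact: jet_L2.
  apply/funext => x; apply: eq_bigr => l _.
  by rewrite /kmul mxE mulr_suml; apply: eq_bigr => j _; rewrite mxE /=; ring.
have im := bounded_coef_integrable mC (bmu i) Hv.1 Hv.1.
rewrite /aE -[leLHS]addr0; apply: lerD.
  rewrite /H1sqsemi -RintegralZl//; apply: ae_le_Rintegral => //.
    exact: integrable_onZ.
  by apply: filterS ell => x ex Cx; rewrite [leRHS]dotvC; apply: ex; exact: CO Cx.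
rewrite -(Rintegral0 (u := fun=> 0) mC)//; apply: ae_le_Rintegral => //.
  exact: integrable0.
apply: filterS mu_ge => x mx Cx; rewrite -mulrA -expr2 mulr_ge0 ?sqr_ge0//.
by rewrite (le_trans mu00)// mx//; exact: CO Cx.
Qed.

Hypotheses (kappa0 : 0 < kappa_lo) (lo0 : 0 < alpha_lo) (up0 : 0 < alpha_up)
  (Cb0 : 0 < C_b) (PF0 : 0 < C_PF).
Hypothesis PF : forall v, Vh D v -> L2sqnorm Omega v <= C_PF * H1hsqsemi D v.
Hypothesis disj : forall i j, i != j -> cell D i `&` cell D j = set0.
Hypothesis bil : forall i,
  [/\ bilinear_on (cell D i) (VhE (D := D) i) (ah D i),
      bilinear_on (cell D i) (VhE (D := D) i) (bh D i),
      forall u v, VhE i u -> VhE i v -> ah D i u v = ah D i v u &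
      forall u v, VhE i u -> VhE i v -> bh D i u v = - bh D i v u].
Hypothesis stab : forall i v, VhE i v ->
  alpha_lo * aE c (cell D i) v v <= ah D i v v <= alpha_up * aE c (cell D i) v v
  /\ bh D i v v = 0.
Hypothesis bh_cont : forall i v w, VhE i v -> VhE i w ->
  bh D i v w <= C_b * H1norm (cell D i) v * H1norm (cell D i) w.

Let VE1 i v : VhE i v -> H1 (cell D i) v.
Proof. exact: (VhE_H1 oC Coo Vfin). Qed.

Lemma aE_ge0 i v : H1 (cell D i) v -> 0 <= aE c (cell D i) v v.
Proof.
move=> Hv; apply: le_trans (aE_coercive Hv); rewrite mulr_ge0 ?(ltW kappa0)//.
by apply: Rintegral_ge0 => x _; apply: sumr_ge0 => j _; rewrite -expr2 sqr_ge0.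
Qed.

Lemma semi_inner_ah i : semi_inner (VhE (D := D) i) (ah D i).
Proof.
have [[lA _ _] _ sA _] := bil i; split=> //.
  exact: (VhE_subspace oC Coo oO Vfin).
move=> v Vv; have [/andP[+ _] _] := stab Vv; apply: le_trans.
by rewrite mulr_ge0 ?(ltW lo0)//; apply: aE_ge0; exact: VE1.
Qed.

(** The stability bound controls only the diagonal values of [ah]; the
    Cauchy-Schwarz inequality for this semi-inner product extends it to all
    pairs. For [bh] the upper bound and skew-symmetry give the lower bound. *)
Lemma AhE_continuous : exists2 K, 0 < K & forall i v w, VhE i v -> VhE i w ->
  `|AhE i v w| <= K * H1norm (cell D i) v * H1norm (cell D i) w.
Proof.
have [K K0 HK] := aE_continuous.
exists (alpha_up * K + C_b); first by rewrite addr_gt0// mulr_gt0.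
move=> i v w Vv Vw; rewrite /AhE (le_trans (ler_normD _ _))// !mulrDl lerD//.
  have sq u : VhE i u -> Num.sqrt (ah D i u u) <=
      Num.sqrt (alpha_up * K) * H1norm (cell D i) u.
    move=> Vu; rewrite -[X in _ * X]ger0_norm ?H1norm_ge0// -sqrtr_sqr -sqrtrM; last first.
      by rewrite mulr_ge0// ltW.
    rewrite ler_wsqrtr//; have [/andP[_ +] _] := stab Vu; move/le_trans; apply.
    rewrite -mulrA ler_wpM2l ?(ltW up0)// expr2 mulrA.
    by apply: le_trans (ler_norm _) _; apply: HK; exact: VE1.
  apply: le_trans (cauchy_schwarz (semi_inner_ah i) Vv Vw) _.
  apply: le_trans (ler_pM _ _ (sq _ Vv) (sq _ Vw)) _; rewrite ?sqrtr_ge0//.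
  by rewrite mulrACA -expr2 sqr_sqrtr ?mulr_ge0 ?(ltW up0) ?(ltW K0)// mulrA.
have [_ _ _ skew] := bil i.
rewrite ler_norml; apply/andP; split; last exact: (bh_cont Vv Vw).
rewrite lerNl -(skew _ _ Vw Vv) mulrAC; exact: (bh_cont Vw Vv).
Qed.

(** The skew part vanishes on the diagonal. The discrete Poincare inequality
    absorbs the L^2 part of the norm, whence the factor [C_PF + 1]. *)
Lemma Ah_coercive : exists2 a, 0 < a & forall v, Vh D v -> a * H1hnorm D v ^+ 2 <= Ah D v v.
Proof.
exists (alpha_lo * kappa_lo / (C_PF + 1)).
  by rewrite divr_gt0 ?mulr_gt0 ?addr_gt0.
move=> v Vv; have Hv := Vh_broken_H1 Vfin Vv.
have nv : H1hnorm D v ^+ 2 <= (C_PF + 1) * H1hsqsemi D v.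
  rewrite sqr_sqrtr; last by apply: sumr_ge0 => i _; rewrite sqr_ge0.
  rewrite (eq_bigr (fun i => L2sqnorm (cell D i) v + H1sqsemi (cell D i) v)).
    rewrite big_split mulrDl mul1r lerD// (le_trans _ (PF Vv))//.
    by apply: (sum_L2sqnorm_le oC oO CO) => //; case: (Vh_H1h Vfin Vv).
  by move=> i _; rewrite (H1norm_sqr oC Coo (Hv i)) (H1ip_sqnorm (oC i) (Hv i)).
apply: le_trans (_ : alpha_lo * kappa_lo * H1hsqsemi D v <= _).
  rewrite -!mulrA ler_wpM2l ?(ltW lo0)// ler_wpM2l ?(ltW kappa0)//.
  by rewrite mulrC ler_pdivrMr ?addr_gt0// mulrC.
rewrite /H1hsqsemi /Ah mulr_sumr; apply: ler_sum => i _.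
have Vi := Vh_VhE Vfin i Vv; have [/andP[+ _] b0] := stab Vi.
rewrite /AhE b0 addr0; apply: le_trans; rewrite -mulrA ler_wpM2l ?(ltW lo0)//.
exact: aE_coercive.
Qed.

Lemma coercivity_continuity_exist :
  exists alpha M M_A M_h : R, coercivity_continuity c D alpha M M_A M_h.
Proof.
have [alpha a0 coer] := Ah_coercive; have [M_A MA0 contA] := AE_continuous.
have [M_h Mh0 conth] := AhE_continuous.
exists alpha, M_h, M_A, M_h; split => // v w Vv Vw.
apply: le_trans (ler_norm_sum _ _ _) _; rewrite -mulrA.
apply: le_trans (_ : M_h * (\sum_i H1norm (cell D i) v * H1norm (cell D i) w) <= _).
  rewrite mulr_sumr; apply: ler_sum => i _; rewrite mulrA; apply: conth.
    exact: (Vh_VhE Vfin i Vv).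
  exact: (Vh_VhE Vfin i Vw).
exact: (ler_wpM2l (ltW Mh0) (sum_H1norm_le D _ _)).
Qed.

End constants.

(** * Passing to the infima and suprema *)

Section extended_reals.
Context {R : realType}.
Local Open Scope ereal_scope.
Implicit Types (S : set (\bar R)) (x y z : \bar R).

Lemma ereal_inf_ge0 S : (forall x, S x -> 0 <= x) -> 0 <= ereal_inf S.
Proof. by move=> S0; apply/ereal_infP => x; exact: S0. Qed.

Lemma ereal_sup_ge0 S : (forall x, S x -> 0 <= x) -> S !=set0 -> 0 <= ereal_sup S.
Proof. by move=> S0 [x Sx]; apply: le_trans (S0 _ Sx) (ereal_sup_ubound Sx). Qed.

(** Nonnegativity excludes a sum of opposite infinities. *)
Lemma le_ereal_infD S (a : R) y : 0 <= y -> (forall x, S x -> 0 <= x) ->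
  (forall x, S x -> a%:E <= x + y) -> a%:E <= ereal_inf S + y.
Proof.
move=> y0 S0 aS; have [yoo|yoo] := eqVneq y +oo.
  by rewrite yoo addey ?leey// gt_eqF// (lt_le_trans _ (ereal_inf_ge0 S0))// ltNyr.
have yfin : y \is a fin_num by rewrite ge0_fin_numE// lt_neqAle yoo leey.
rewrite -leeBlDr//; apply/ereal_infP => x Sx.
by rewrite leeBlDr//; exact: aS.
Qed.

End extended_reals.

Section abstract_error_estimate.
Context {R : realType} {d : nat}.
Local Notation X := 'rV[R]_d.
Local Notation lam := (@lebesgue_rV R d).
Variables (Omega : set X) (c : coefficients R d) (f : X -> R)
  (kappa_lo kappa_up mu0 : R) (D : discretization R d) (h : R) (k N : nat)
  (C_PF alpha_lo alpha_up C_b : R).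
Hypotheses (d0 : (0 < d)%N)
  (CP : continuous_problem c Omega f kappa_lo kappa_up mu0)
  (A1 : assumption_A1 D Omega h k N C_PF)
  (A2 : assumption_A2 c D k alpha_lo alpha_up C_b).
Implicit Types (u v w p : X -> R) (i : elt D).

Let PO : polytopal_domain Omega. Proof. by case: CP. Qed.
Let oO : open Omega := polytopal_domain_open PO.
Let mO : measurable Omega := open_measurable_rV oO.
Let PC i : polytopal_domain (cell D i).
Proof. by case: A1 => -[_ _ [[+ _ _] _ _ _ _]] _ _ _ _ => /(_ i)[]. Qed.
Let oC i : open (cell D i) := polytopal_domain_open (PC i).
Arguments oC : clear implicits.
Let Coo i : (lam (cell D i) < +oo)%E := polytopal_domain_lty (PC i).
Let CO i : cell D i `<=` Omega.
Proof. by case: A1 => -[_ _ [_ + _ _ _]] _ _ _ _; exact. Qed.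
Arguments CO : clear implicits.
Let mC i : measurable (cell D i) := open_measurable_rV (oC i).
Let Vfin : findim_subspace D Omega (Vh D).
Proof. by case: A1. Qed.

Let bLinf i w : Linf Omega w -> bounded_coef (cell D i) w.
Proof. exact: (Linf_bounded_coef (mC i) mO (CO i)). Qed.

Let bkappa i l m : bounded_coef (cell D i) (fun x => kappa c x l m).
Proof. by apply: bLinf; case: CP => _ [+ _ _ _] _ _ _; exact. Qed.

Let bbeta i l : bounded_coef (cell D i) (fun x => beta c x 0 l).
Proof. by apply: bLinf; case: CP => _ [_ + _ _] _ _ _; exact. Qed.

Let bmu i : bounded_coef (cell D i) (mu c).
Proof.
have [_ [_ _ bg _] [_ bd] _ _] := CP.
rewrite (_ : mu c = fun x => - 2^-1 * divbeta c x + gamma c x).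
  by apply: bounded_coef_lin => //; exact: bLinf.
by apply/funext => x; rewrite /mu mulNr addrC.
Qed.

Let bilA i : bilinear_on (cell D i) (VhE (D := D) i) (AhE (D := D) i).
Proof. by case: A1 => _ _ _ _ [+ _]; exact. Qed.

Lemma constants_exist : exists alpha M M_A M_h : R, coercivity_continuity c D alpha M M_A M_h.
Proof.
have [_ _ _ [kl0 _ _ kell] [mu00 mu_ge]] := CP.
have [[_ _ [[_ disj _] _ _ _ _]] _ [PF0 PF] _ _] := A1.
have [bil _ [lo0 up0 Cb0] stab bcont] := A2.
have ell : {ae lam, forall x, Omega x -> forall xi : X,
    kappa_lo * dotv xi xi <= dotv xi (kmul c x xi)}.
  apply: (pointwise_ellipticity
    (Q := fun x xi => kappa_lo * dotv xi xi <= dotv xi (kmul c x xi)) d0 oO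
    (polytopal_domain_lty PO)).
  by apply: filterS kell => x kx Ox v Hv; case/andP: (kx Ox v Hv).
exact: (coercivity_continuity_exist oC Coo oO CO Vfin bkappa bbeta bmu ell mu00 mu_ge
  kl0 lo0 up0 Cb0 PF0 PF disj bil stab bcont).
Qed.

Let VhE_cst i : VhE i (fun=> 1).
Proof. by case: A1 => _ _ _ + _; apply; exact: polyn_cst. Qed.

(** The constant 1 is a polynomial, so on each element it is the restriction of
    a discrete function; and there is at least one element. *)
Lemma Vh_neq0 : exists w, Vh D w /\ ~ aeeq Omega w (fun=> 0).
Proof.
have [i _] : exists i, diam (cell D i) = h by case: A1 => -[_ _ [_ _ [_]]].
have [_ [w Vw w1]] := VhE_cst i; exists w; split => // w0.
apply: (@polytopal_domain_cst _ _ _ 1 0 (PC i)); first exact: oner_neq0.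
by apply: aeeq_trans w1 _; exact: aeeq_S (CO i) w0.
Qed.

Lemma load_error_ge0 : (0 <= load_error D Omega f)%E.
Proof.
apply: ereal_sup_ge0 => [_ [v _ <-]|]; first by rewrite lee_fin divr_ge0 ?sqrtr_ge0.
by have [w Vw] := Vh_neq0; eexists; exists w.
Qed.

Lemma nonconformity_error_ge0 u : (0 <= nonconformity_error c D Omega f u)%E.
Proof.
apply: ereal_sup_ge0 => [_ [v _ <-]|]; first by rewrite lee_fin divr_ge0 ?sqrtr_ge0.
by have [w Vw] := Vh_neq0; eexists; exists w.
Qed.

Lemma local_inconsistency_ge0 i p : (0 <= local_inconsistency c i p)%E.
Proof.
apply: ereal_sup_ge0 => [_ [v _ <-]|]; first by rewrite lee_fin divr_ge0 ?sqrtr_ge0.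
eexists; exists (fun=> 1) => //; split; first exact: VhE_cst.
by apply: polytopal_domain_cst => //; exact: oner_neq0.
Qed.

Variables (alpha M M_A M_h : R).
Hypothesis cc : coercivity_continuity c D alpha M M_A M_h.

Lemma strang_constant_gt0 : 0 < strang_constant alpha M_A M_h.
Proof.
have [[a0 _ A0 H0] _ _ _ _] := cc.
by rewrite addr_gt0// divr_gt0// !addr_gt0.
Qed.

(** If one of the errors is infinite there is nothing to prove. Otherwise each
    supremum, times the norm of e = uh - vh, bounds the corresponding residual;
    an element on which e has norm zero contributes nothing, by continuity. *)
Lemma strang_pointwise u uh vh p : broken_H1 D u -> Vh D uh ->
  (forall v, Vh D v -> Ah D uh v = fh D v) -> Vh D vh -> polyh D Omega k p ->
  ((H1hnorm D (u \- uh) / strang_constant alpha M_A M_h)%:E <=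
   (H1hnorm D (u \- vh))%:E + load_error D Omega f +
   ((H1hnorm D (u \- p))%:E + \sum_(i : elt D) local_inconsistency c i p) +
   nonconformity_error c D Omega f u)%E.
Proof.
move=> Hu Vuh Auh Vvh [p2 pk].
have Vp i : VhE i p.
  have [q qk pq] := pk i; have [_ _ _ Vq _] := A1.
  by apply: VhE_aeeq pq (Vq i _ qk); exact: L2_S p2.
have l0 := load_error_ge0; have n0 := nonconformity_error_ge0 u.
have s0 i := local_inconsistency_ge0 i p.
have S0 : (0 <= \sum_(i : elt D) local_inconsistency c i p)%E by exact: sume_ge0.
set l := load_error D Omega f in l0 *; set n := nonconformity_error c D Omega f u in n0 *.
set S := (\sum_i _)%E in S0 *.
have [RF|] := boolP (((H1hnorm D (u \- vh))%:E + l + ((H1hnorm D (u \- p))%:E + S) + n)%E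
    \is a fin_num); last first.
  rewrite ge0_fin_numE; last by rewrite !adde_ge0// lee_fin H1hnorm_ge0.
  by rewrite -leNgt leye_eq => /eqP ->; exact: leey.
move: RF; rewrite !fin_numD => /andP[/andP[/andP[_ lF] /andP[_ SF]] nF].
have sF i : local_inconsistency c i p \is a fin_num.
  by apply: (sum_fin_numP _ _ _ SF); rewrite ?mem_index_enum.
have SE : S = (\sum_(i : elt D) fine (local_inconsistency c i p))%:E.
  by rewrite -sumEFin; apply: eq_bigr => i _; rewrite fineK.
have Ve : Vh D (uh \- vh) := Vh_sub oC Coo oO Vfin Vuh Vvh.
have He := Vh_broken_H1 Vfin Ve.
have Hp i := VhE_H1 oC Coo Vfin (Vp i).
set C := strang_constant alpha M_A M_h; have C0 : 0 < C by exact: strang_constant_gt0.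
have [[a'0 M0 MA0 Mh0] _ _ contA contAh] := cc.
rewrite SE -[l]fineK// -[n]fineK// -!EFinD lee_fin ler_pdivrMr// mulrC.
have fl0 : 0 <= fine l by exact: fine_ge0.
have fn0 : 0 <= fine n by exact: fine_ge0.
have fs0 i : 0 <= fine (local_inconsistency c i p) by apply: fine_ge0; exact: s0.
(* the suprema give no information when e vanishes, but then the triangle
   inequality alone suffices *)
have [N0|Npos] := eqVneq (H1hnorm D (uh \- vh)) 0.
  have Huh := Vh_broken_H1 Vfin Vuh; have Hvh := Vh_broken_H1 Vfin Vvh.
  have tri := H1hnorm_triangle oC Coo Hu Hvh Huh.
  rewrite -(H1hnorm_subC oC Coo Huh Hvh) N0 addr0 in tri.
  apply: le_trans tri _.
  have C1 : 1 <= C.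
    by rewrite lerDl divr_ge0 ?(ltW a'0)// !addr_ge0 ?(ltW MA0) ?(ltW Mh0).
  apply: le_trans (_ : H1hnorm D (u \- vh) + fine l + (H1hnorm D (u \- p) +
      \sum_(i : elt D) fine (local_inconsistency c i p)) + fine n <= _).
    by rewrite -!addrA lerDl !addr_ge0 ?H1hnorm_ge0// sumr_ge0.
  by rewrite ler_peMl// !addr_ge0 ?H1hnorm_ge0// sumr_ge0.
have {}Npos : 0 < H1hnorm D (uh \- vh) by rewrite lt_neqAle eq_sym Npos H1hnorm_ge0.
have e0 : ~ aeeq Omega (uh \- vh) (fun=> 0).
  by move=> /(aeeq0_H1hnorm oC Coo CO He) eN; rewrite eN ltxx in Npos.
apply: (strang_bound oC Coo oO Vfin bkappa bbeta bmu bilA cc Hu Vuh Auh Vvh Vp fs0) => //.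
- rewrite -ler_pdivrMr// -lee_fin fineK//; apply: ereal_sup_ubound.
  by exists (uh \- vh).
- rewrite -ler_pdivrMr// -lee_fin fineK//; apply: ereal_sup_ubound.
  by exists (uh \- vh).
move=> i; have [ni|ni] := eqVneq (H1norm (cell D i) (uh \- vh)) 0.
  have := contA i _ _ (Hp i) (He i); have := contAh i _ _ (Vp i) (Vh_VhE Vfin i Ve).
  rewrite ni !mulr0 !normr_le0 => /eqP -> /eqP ->; by rewrite subr0.
have {}ni : 0 < H1norm (cell D i) (uh \- vh) by rewrite lt_neqAle eq_sym ni H1norm_ge0.
rewrite -ler_pdivrMr// -lee_fin fineK//; apply: ereal_sup_ubound.
exists (uh \- vh) => //; split; first exact: (Vh_VhE Vfin i Ve).
by move=> /(aeeq0_H1norm (oC i) (Coo i) (He i)) eN; rewrite eN ltxx in ni.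
Qed.

Lemma strang_estimate u uh : H1 Omega u -> Vh D uh ->
  (forall v, Vh D v -> Ah D uh v = fh D v) ->
  ((H1hnorm D (u \- uh))%:E <= (strang_constant alpha M_A M_h)%:E *
   (best_approximation D u + load_error D Omega f + polynomial_error c D Omega k u +
    nonconformity_error c D Omega f u))%E.
Proof.
move=> Hu Vuh Auh; have l0 := load_error_ge0; have n0 := nonconformity_error_ge0 u.
have Hbu : broken_H1 D u by move=> i; exact: H1_S (CO i) Hu.
have C0 := strang_constant_gt0.
have p0 : (0 <= polynomial_error c D Omega k u)%E.
  apply: ereal_inf_ge0 => _ [p _ <-]; rewrite adde_ge0 ?lee_fin ?H1hnorm_ge0//.
  by apply: sume_ge0 => i _; exact: local_inconsistency_ge0.
rewrite muleC -lee_pdivrMr// -EFinM -!addeA.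
apply: le_ereal_infD => [|_ [v _ <-]|_ [v Vv <-]].
- by rewrite !adde_ge0.
- by rewrite lee_fin H1hnorm_ge0.
rewrite [X in (_ <= _ + X)%E]addeCA [X in (_ <= X)%E]addeCA.
apply: le_ereal_infD => [|_ [p _ <-]|_ [p Pp <-]].
- by rewrite !adde_ge0 ?lee_fin ?H1hnorm_ge0.
- rewrite adde_ge0 ?lee_fin ?H1hnorm_ge0//.
  by apply: sume_ge0 => i _; exact: local_inconsistency_ge0.
apply: le_trans (strang_pointwise Hbu Vuh Auh Vv Pp) _.
by rewrite -[X in (X <= _)%E]addeA -[X in (X <= _)%E]addeA
  [X in (_ + X <= _)%E]addeCA [X in (X <= _)%E]addeCA.
Qed.

Lemma nonconformity_error_conforming u : (forall v, H10 Omega v -> A c D u v = ip Omega f v) ->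
  Vh D `<=` H10 Omega -> nonconformity_error c D Omega f u = 0%E.
Proof.
move=> Au VH.
apply/eqP; rewrite eq_le nonconformity_error_ge0 andbT; apply: ub_ereal_sup => _ [w [Vw _] <-].
by rewrite Au ?subrr ?normr0 ?mul0r//; exact: VH.
Qed.

End abstract_error_estimate.

Theorem theorem3p3 (R : realType) :
  exists C : R -> R -> R -> R -> R,
    (forall alpha M M_A M_h : R, 0 < alpha -> 0 < M -> 0 < M_A -> 0 < M_h ->
       0 < C alpha M M_A M_h) /\
    forall (d : nat) (Omega : set 'rV[R]_d) (c : coefficients R d)
      (f : 'rV[R]_d -> R) (kappa_lo kappa_up mu0 : R)
      (D : discretization R d) (h : R) (k N : nat)
      (C_PF alpha_lo alpha_up C_b : R),
    d = 2%N \/ d = 3%N ->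
    continuous_problem c Omega f kappa_lo kappa_up mu0 ->
    assumption_A1 D Omega h k N C_PF ->
    assumption_A2 c D k alpha_lo alpha_up C_b ->
    forall u uh : 'rV[R]_d -> R,
    H10 Omega u -> (forall v, H10 Omega v -> A c D u v = ip Omega f v) ->
    Vh D uh -> (forall v, Vh D v -> Ah D uh v = fh D v) ->
    [/\ exists alpha M M_A M_h : R, coercivity_continuity c D alpha M M_A M_h,
        forall alpha M M_A M_h : R, coercivity_continuity c D alpha M M_A M_h ->
          ((H1hnorm D (u \- uh))%:E <=
           (C alpha M M_A M_h)%:E *
           (best_approximation D u + load_error D Omega f +
            polynomial_error c D Omega k u +
            nonconformity_error c D Omega f u))%E &
        nonconformity_error c D Omega f u <> 0%E -> ~ (Vh D `<=` H10 Omega)].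
Proof.
exists (fun alpha _ M_A M_h => strang_constant alpha M_A M_h); split.
  by move=> alpha M M_A M_h a0 M0 A0 H0; rewrite addr_gt0// divr_gt0// !addr_gt0.
move=> d Omega c f kappa_lo kappa_up mu0 D h k N C_PF alpha_lo alpha_up C_b d23 CP A1 A2.
move=> u uh [Hu _] Au Vuh Auh.
have d0 : (0 < d)%N by case: d23 => ->.
split; first exact: (constants_exist d0 CP A1 A2).
  by move=> alpha M M_A M_h cc; exact: (strang_estimate CP A1 cc).
by move=> nz VH; apply: nz; exact: (nonconformity_error_conforming A1).
Qed.
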